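(* Let $(V,E,\Phi)$ be a graph with Euclidean edges such that $(V,E)$ is a tree, and let $L$ be the corresponding network. Let $p$ be a measurable function from the set of finite point configurations in $L$ into $[0,\infty)$. Then $p$ is a Markov function on the family of configurations in general position with respect to the Delaunay relation if and only if $$p(\mathbf{x})\propto 1\{\gamma(\mathbf{x})>0\}\,\prod_{x_i\in\mathbf{x}}\gamma(\{x_i\})\,\prod_{i<j:\,x_i\sim_{\mathbf{x}}x_j}\gamma(\{x_i,x_j\})$$ for all configurations $\mathbf{x}=\{x_1,\dots,x_n\}$ in general position, for some measurable, non-negative interaction function $\gamma$. Here $\propto$ means equality up to a positive constant not depending on $\mathbf{x}$.
   Context: **Graph with Euclidean edges.** A graph with Euclidean edges in $\mathbb{R}^2$ is a triple $(V,E=(e_i)_{i=1}^{n(E)},\Phi=(\phi_i)_{i=1}^{n(E)})$ such that $(V,E)$ is a finite, simple (no loops, no multiple edges), connected graph with $V\subset\mathbb{R}^2$, and every edge $e_i=\{v_i^1,v_i^2\}\in E$ is parametrised by the inverse of a bijection $\phi_i$: $\phi_i^{-1}:J_i\to\mathbb{R}^2$ for a non-empty open interval $J_i\subset\mathbb{R}$ with (finite) endpoints $\phi_i(v_i^j)$, $j=1,2$ (so $\phi_i^{-1}$ extends to the closed interval $\bar J_i$ and maps its endpoints to the endpoints of $e_i$). The parametrisations are assumed to be diffeomorphisms onto their images. **Network.** $L=(\{0\}\times V)\cup\bigcup_{i=1}^{n(E)}(\{i\}\times\phi_i^{-1}(J_i))$. Labels identify edges, so edge interiors with different labels are disjoint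 in $L$ even if the curves overlap in $\mathbb{R}^2$. $L$ carries the finite disjoint union $\sigma$-algebra: a set is measurable iff it is $\bigcup_{i=0}^{n(E)}(\{i\}\times B_i)$ with $B_0\subseteq V$ arbitrary and, for $i>0$, $B_i=\phi_i^{-1}(B)$ with $B\subseteq J_i$ Borel. A (point) configuration is a finite set of distinct points of $L$; the set of configurations is equipped with the $\sigma$-algebra generated by the counts $\mathbf{x}\mapsto n(\mathbf{x}\cap B)$, $B\subseteq L$ measurable. **Length and distance.** The length of $\phi_i^{-1}(B)$, $B\subseteq\bar J_i$ Borel, is the Euclidean length of $B$; in particular $e_i$ has length $|J_i|$. A walk between two elements $(i,x)$, $(j,y)$ of $L$ travels alternatingly along a finite number of vertices and edges, such that the vertices are endpoints of the edges; if $i\neq0$ it starts along a piece of edge $i$ from $x$, and if $j\neq0$ it ends along a piece of edge $j$ to $y$; it does not reverse its tracks within an edge. A path between two different elements is a walk in which all edge segments are different (non-overlapping) and all vertices are different. The weight of a path is the sum of the lengths of its edge segments. The (weighted) shortest path distance $d_G$ between two elements of $L$ is the smallest weight of a path between them (and $0$ if they are equal); $d_G$ is a metric. **Delaunay relation.** For a finite configuration $\mathbf{x}\subseteq L$ and $x_j\in\mathbf{x}$, the Voronoi cell is $C(x_j\mid\mathbf{x})=\{\eta\in L: d_G(\eta,x_j)\le d_G(\eta,x)\text{ for all }x\in\mathbf{x}\}$. The Delaunay relation on $\mathbf{x}$ is $x_1\sim_{\mathbf{x}}x_2\Leftrightarrow C(x_1\mid\mathbf{x})\cap C(x_2\mid\mathbf{x})\neq\emptyset$.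 For $\mathbf{z}\subseteq\mathbf{x}$, $N(\mathbf{z}\mid\mathbf{x})=\{x\in\mathbf{x}:x\sim_{\mathbf{x}}z\text{ for some }z\in\mathbf{z}\}$. **General position.** A configuration is in general position if no three of its points lie on the boundary of the same $d_G$-ball, i.e. there are no $c\in L$, $r>0$ and three distinct points of the configuration all at $d_G$-distance exactly $r$ from $c$. Subsets of configurations in general position are in general position. **Markov function.** $p$ is a Markov function with respect to $\sim_{\mathbf{x}}$ if for all $\mathbf{x}$ with $p(\mathbf{x})>0$: (a) $p(\mathbf{y})>0$ for all $\mathbf{y}\subseteq\mathbf{x}$; (b) for all $u\in L$, the ratio $p(\mathbf{x}\cup\{u\})/p(\mathbf{x})$ depends only on $u$, on $N(\{u\}\mid\mathbf{x}\cup\{u\})\cap\mathbf{x}=\{x\in\mathbf{x}:x\sim_{\mathbf{x}\cup\{u\}}u\}$ and on the relations $\sim_{\mathbf{x}},\sim_{\mathbf{x}\cup\{u\}}$ restricted to $N(\{u\}\mid\mathbf{x}\cup\{u\})$ (that is, two pairs $(\mathbf{x},u)$, $(\mathbf{x}',u)$ with $p(\mathbf{x}),p(\mathbf{x}')>0$ for which these data coincide give the same ratio). **Interaction function.** A function $\gamma$ from the space of finite point configurations into $[0,\infty)$ is an interaction function if $\gamma(\mathbf{x})>0$ implies (a) $\gamma(\mathbf{y})>0$ for all $\mathbf{y}\subseteq\mathbf{x}$ and (b) for $u\in L$, if additionally $\gamma(N(\{u\}\mid\mathbf{x}\cup\{u\}))>0$, then $\gamma(\mathbf{x}\cup\{u\})>0$.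 ''On the family of configurations in general position'' means that all configurations occurring in these conditions ($\mathbf{x}$ and $\mathbf{x}\cup\{u\}$) are taken in general position. *)

(* Defs.v *)
(* MathComp-Analysis *)
From mathcomp Require Import all_boot all_order all_algebra finmap.
From mathcomp Require Import all_classical all_reals all_analysis.

Set Implicit Arguments.
Unset Strict Implicit.
Unset Printing Implicit Defensive.

Import Order.TTheory GRing.Theory Num.Theory.
Import numFieldNormedType.Exports.

Local Open Scope classical_set_scope.
Local Open Scope ring_scope.

Section Diffeo.
Variable R : realType.

(* [f] is a C^1 diffeomorphism from the open interval ]a, b[ onto its image in
   the plane: it is C^1, and it has a left inverse which near every point of
   the image is the restriction of a C^1 function on an open set. *)
Definition diffeo_onto_image (a b : R) (f : R -> 'rV[R]_2) : Prop :=
  [/\ forall t, a < t < b -> derivable f t 1,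
      forall t, a < t < b -> {for t, continuous (derive1 f)} &
      forall t, a < t < b ->
        exists (U : set 'rV[R]_2) (g : 'rV[R]_2 -> R),
        [/\ open U /\ U (f t),
            forall y, U y -> differentiable g y,
            forall y v, U y -> {for y, continuous (fun x => 'd g x v : R)} &
            forall s, a < s < b -> U (f s) -> g (f s) = s] ].

End Diffeo.

Section Graph.
Variables (K : choiceType) (V : {fset K}) (n : nat) (e : 'I_n -> {fset K}).

Definition adj : rel V := fun u v => [exists i, e i == [fset val u; val v]%fset].

Definition connected_graph : Prop :=
  V != fset0%fset /\ forall u v : V, connect adj u v.

Definition acyclic_graph : Prop :=
  forall s : seq V, ucycle adj s -> (size s <= 2)%N.

End Graph.

(* [param i] is the inverse of the bijection phi_i, extended to the closed
   interval [lo i, hi i]; its values outside that interval are irrelevant. *)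
Record euclidean_graph (R : realType) := EuclideanGraph {
  vertices : {fset 'rV[R]_2};
  nedges : nat;
  edge : 'I_nedges -> {fset 'rV[R]_2};
  lo : 'I_nedges -> R;
  hi : 'I_nedges -> R;
  param : 'I_nedges -> R -> 'rV[R]_2;
  edge_sub : forall i, (edge i `<=` vertices)%fset;
  edge_no_loop : forall i, #|` edge i| = 2%N;
  edge_no_multi : injective edge;
  graph_connected : connected_graph vertices edge;
  lo_lt_hi : forall i, lo i < hi i;
  param_ends : forall i, edge i = [fset param i (lo i); param i (hi i)]%fset;
  param_inj : forall i, {in `[lo i, hi i] &, injective (param i)};
  param_cont : forall i, {within `[lo i, hi i], continuous (param i)};
  param_diffeo : forall i, diffeo_onto_image (lo i) (hi i) (param i)
}.

Definition is_tree (R : realType) (G : euclidean_graph R) : Prop :=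
  connected_graph (vertices G) (@edge R G) /\
  acyclic_graph (vertices G) (@edge R G).

Section Network.
Variables (R : realType) (G : euclidean_graph R).

(* Label [None] is the label 0 of vertices, [Some i] the label of edge i. *)
Definition labelled_point : Type := (option 'I_(nedges G) * 'rV[R]_2)%type.

Definition network_set : set labelled_point :=
  [set z | match z.1 with
           | None => z.2 \in vertices G
           | Some i => (param i @` `]lo i, hi i[) z.2
           end].

Definition network : Type := set_type network_set.

Definition network_measurable (B : set network) : Prop :=
  forall i : 'I_(nedges G), exists A : set R,
    [/\ measurable A, A `<=` `]lo i, hi i[ &
        [set q | exists2 z, B z & val z = (Some i, q)] = param i @` A].

Definition config : Type := {fset network}.

Definition npoints (B : set network) (X : config) : nat :=
  #|` [fset z in X | z \in B]%fset|.

Definition count_events : set (set config) :=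
  [set Y | exists (B : set network) (k : nat),
     network_measurable B /\ Y = [set X | npoints B X = k]].

Definition config_measurable (p : config -> R) : Prop :=
  measurable_fun setT (p : g_sigma_algebraType count_events -> R).

(* A segment (i, s, t) runs along edge i from parameter s to parameter t. *)
Definition segment : Type := ('I_(nedges G) * R * R)%type.

Definition seg_edge (g : segment) : 'I_(nedges G) := g.1.1.
Definition seg_from (g : segment) : R := g.1.2.
Definition seg_to (g : segment) : R := g.2.

Definition valid_segment (g : segment) : bool :=
  let i := seg_edge g in
  [&& lo i <= seg_from g <= hi i, lo i <= seg_to g <= hi i
    & seg_from g != seg_to g].

(* The endpoints of the closed parameter interval denote vertices, so they
   carry the vertex label. *)
Definition edge_point (i : 'I_(nedges G)) (t : R) : labelled_point :=
  (if lo i < t < hi i then Some i else None, param i t).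

Definition seg_src (g : segment) : labelled_point :=
  edge_point (seg_edge g) (seg_from g).
Definition seg_tgt (g : segment) : labelled_point :=
  edge_point (seg_edge g) (seg_to g).

Definition is_vertex (z : labelled_point) : bool := z.1 == None.

Definition joined_at_vertex (g h : segment) : bool :=
  (seg_tgt g == seg_src h) && is_vertex (seg_tgt g).

(* Since consecutive segments meet at vertices, every segment other than the
   first and the last is a whole edge. *)
Definition is_walk (x y : network) (w : seq segment) : Prop :=
  if w is g :: w' then
    [/\ all valid_segment w, path joined_at_vertex g w',
        seg_src g = val x & seg_tgt (last g w') = val y]
  else False.

Definition walk_vertices (w : seq segment) : seq labelled_point :=
  if w is g :: _ then [seq z <- seg_src g :: map seg_tgt w | is_vertex z]
  else [::].

Definition nonoverlapping (g h : segment) : bool :=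
  (seg_edge g == seg_edge h) ==>
  ((Num.max (seg_from g) (seg_to g) <= Num.min (seg_from h) (seg_to h)) ||
   (Num.max (seg_from h) (seg_to h) <= Num.min (seg_from g) (seg_to g))).

Definition is_path (x y : network) (w : seq segment) : Prop :=
  [/\ is_walk x y w, pairwise nonoverlapping w & uniq (walk_vertices w)].

Definition path_weight (w : seq segment) : R :=
  \sum_(g <- w) `|seg_to g - seg_from g|.

(* Between two different points there are finitely many and at least one path,
   so the infimum is a minimum. *)
Definition dG (x y : network) : R :=
  if x == y then 0
  else inf [set r | exists2 w, is_path x y w & r = path_weight w].

Definition voronoi_cell (X : config) (x : network) : set network :=
  [set eta | forall y, y \in X -> dG eta x <= dG eta y].

Definition delaunay (X : config) (x y : network) : Prop :=
  [/\ x \in X, y \in X & voronoi_cell X x `&` voronoi_cell X y !=set0].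

Definition neighbours (Z X : config) : config :=
  [fset x in X | `[< exists2 z, z \in Z & delaunay X x z >]]%fset.

Definition general_position (X : config) : Prop :=
  ~ exists (c : network) (r : R) (x y z : network),
      [/\ 0 < r, [/\ x \in X, y \in X & z \in X],
          [/\ x != y, y != z & x != z] &
          [/\ dG c x = r, dG c y = r & dG c z = r]].

Definition same_local_data (u : network) (X X' : config) : Prop :=
  let Xu : config := (u |` X)%fset in
  let X'u : config := (u |` X')%fset in
  let N := neighbours [fset u]%fset Xu in
  let N' := neighbours [fset u]%fset X'u in
  [/\ (N `&` X)%fset = (N' `&` X')%fset,
      forall a b, a \in N -> b \in N -> delaunay X a b <-> delaunay X' a b &
      forall a b, a \in N -> b \in N -> delaunay Xu a b <-> delaunay X'u a b].

Definition markov_function (p : config -> R) : Prop :=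
  forall X, general_position X -> 0 < p X ->
    (forall Y : config, (Y `<=` X)%fset -> 0 < p Y) /\
    (forall u, general_position (u |` X)%fset ->
       forall X' : config, general_position X' -> 0 < p X' ->
         general_position (u |` X')%fset -> same_local_data u X X' ->
         p (u |` X)%fset / p X = p (u |` X')%fset / p X').

Definition interaction_function (gam : config -> R) : Prop :=
  forall X, general_position X -> 0 < gam X ->
    (forall Y : config, (Y `<=` X)%fset -> 0 < gam Y) /\
    (forall u, general_position (u |` X)%fset ->
       0 < gam (neighbours [fset u]%fset (u |` X)%fset) ->
       0 < gam (u |` X)%fset).

Definition pairwise_density (gam : config -> R) (X : config) : R :=
  let x := tnth (in_tuple X) in
  (0 < gam X)%R%:R *
  (\prod_(i < #|` X|) gam [fset x i]%fset) *
  (\prod_(i < #|` X|)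
     \prod_(j < #|` X| | (i < j)%N && `[< delaunay X (x i) (x j) >])
       gam [fset x i; x j]%fset).

End Network.

(* Main.v *)
(* On a tree, d_G is the l1 distance between the vectors of coordinates
   (pi_i x)_i, where pi_i projects the network onto edge i.  For i <> j one of
   pi_i, pi_j is always at the point where the two edges face each other, which
   yields the four-point inequality.  With midpoints it turns the Delaunay
   relation into the relative neighbourhood relation: x ~ y iff no point of the
   configuration is closer to both x and y than they are to each other.  Hence
   in general position there are no three pairwise related points, and the
   relations among the neighbours of a new point u are determined by these
   neighbours alone.  So p(X u)/p(X) = p(Y u)/p(Y) with Y the neighbours of u
   in X, and the factorization follows by induction on the number of points. *)

(* Passing to the neighbours of [u] advances the induction only if [u] together with its neighbours
   is smaller than the whole configuration, which fails when [u] is related to every other point.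
   The absence of triangles supplies a good [u]: among any three points two are unrelated, and one
   of these two can be removed. The factorized function must obey the same reduction to neighbours,
   so sufficiency is proved before necessity and is then applied to the candidate itself. The
   candidate comes from solving the factorization on at most two points, where all points are
   related: the constant is p({}), a point has potential p({x}) / p({}), and a pair has potential
   p({x,y}) p({}) / (p({x}) p({y})). The measurability of the last denominator takes an argument of
   its own, since the two points of a configuration come in no measurable order. *)
Require Import Defs.
From mathcomp Require Import all_boot all_order all_algebra finmap.
From mathcomp Require Import all_classical all_reals all_analysis.
From mathcomp Require Import measurable_realfun ring lra.

Set Implicit Arguments.
Unset Strict Implicit.
Unset Printing Implicit Defensive.

Import Order.TTheory GRing.Theory Num.Theory.

Local Open Scope classical_set_scope.
Local Open Scope ring_scope.

(** * The metric of a tree *)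

Section Tree.
Variables (R : realType) (G : euclidean_graph R).
Hypothesis hG : is_tree G.

Notation E := 'I_(nedges G).
Notation V := (vertices G).
Notation adjG := (@adj _ V _ (@edge R G)).
Implicit Types (i j : E) (u v : V) (z : labelled_point G).
Implicit Types (g : segment G) (w : seq (segment G)).

Definition vpt (v : V) : labelled_point G := (None, val v).

Lemma param_vertex i t : t = lo i \/ t = hi i -> param i t \in V.
Proof.
move=> ht; apply: (fsubsetP (edge_sub i)); rewrite param_ends !inE.
by case: ht => ->; rewrite eqxx ?orbT.
Qed.

Definition lo_vtx i : V := [` param_vertex (or_introl (erefl (lo i))) ]%fset.
Definition hi_vtx i : V := [` param_vertex (or_intror (erefl (hi i))) ]%fset.

(** * Deleting an edge, and the projection onto it *)

Definition adj_minus i : rel V := fun u v =>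
  [exists j : E, (j != i) && (edge j == [fset val u; val v]%fset)].

Lemma adj_minus_sym i : symmetric (adj_minus i).
Proof. by move=> u v; apply: eq_existsb => j; rewrite fsetUC. Qed.

Lemma adj_minus_sub i : subrel (adj_minus i) adjG.
Proof. by move=> u v /existsP[j /andP[_ ej]]; apply/existsP; exists j. Qed.

(** A simple walk avoiding edge [i] between its ends would close up with edge [i] to a cycle. The
    bound on cycles leaves two lengths, each excluded otherwise: with one vertex the two ends would
    coincide, with two vertices there would be a parallel edge. *)
Lemma edge_ends_disconnected i : ~~ connect (adj_minus i) (lo_vtx i) (hi_vtx i).
Proof.
apply/negP => /connectP[p0 pp0 l0]; case/shortenP: pp0 l0 => p pp up _ lp.
have ei : edge i = [fset val (hi_vtx i); val (lo_vtx i)]%fset.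
  by rewrite param_ends fsetUC.
have: ucycle adjG (lo_vtx i :: p).
  rewrite /ucycle up andbT /= rcons_path (sub_path (@adj_minus_sub i)) //=.
  by rewrite -lp; apply/existsP; exists i; rewrite ei.
move/(hG.2 _) => /=; case: p pp up lp => [_ _ /(congr1 val) /= e|v [|//]] /=.
  have := param_inj (i := i) (x := hi i) (y := lo i); rewrite !in_itv /= !lexx !(ltW (lo_lt_hi i)).
  by move=> /(_ isT isT e) /esym e'; have := lo_lt_hi i; rewrite e' ltxx.
rewrite andbT => /existsP[j /andP[ji /eqP ej]] _ hv _; move: ej.
rewrite -hv fsetUC -ei => /edge_no_multi jj; by rewrite jj eqxx in ji.
Qed.

Definition side i (q : 'rV[R]_2) : R :=
  if [exists v : V, (val v == q) && connect (adj_minus i) (lo_vtx i) v]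
  then lo i else hi i.

Definition coord i z : R :=
  match z.1 with
  | None => side i z.2
  | Some j => if j == i then
                xget (lo i) [set t | lo i < t < hi i /\ param i t = z.2]
              else side i (param j (lo j))
  end.

Lemma side_vtx i v :
  side i (val v) = if connect (adj_minus i) (lo_vtx i) v then lo i else hi i.
Proof.
rewrite /side; congr (if _ then _ else _).
apply/existsP/idP => [[v' /andP[/eqP/val_inj ->]]//|c].
by exists v; rewrite eqxx.
Qed.

Lemma side_adj i u v : adj_minus i u v -> side i (val u) = side i (val v).
Proof.
move=> a; rewrite !side_vtx; congr (if _ then _ else _).
have sc : connect_sym (adj_minus i) by apply: sym_connect_sym; exact: adj_minus_sym.
exact: (same_connect_r sc (connect1 a)).
Qed.

Lemma side_lo i : side i (param i (lo i)) = lo i.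
Proof. by rewrite -[param _ _]/(val (lo_vtx i)) side_vtx connect0. Qed.

Lemma side_hi i : side i (param i (hi i)) = hi i.
Proof. by rewrite -[param _ _]/(val (hi_vtx i)) side_vtx (negPf (edge_ends_disconnected i)). Qed.

Lemma side_edge i j : j != i -> side i (param j (hi j)) = side i (param j (lo j)).
Proof.
move=> ji; rewrite -[param j (hi j)]/(val (hi_vtx j)) -[param j (lo j)]/(val (lo_vtx j)).
by apply: side_adj; apply/existsP; exists j; rewrite ji param_ends fsetUC eqxx.
Qed.

Lemma itv_ends (a b t : R) : a <= t <= b -> [\/ a < t < b, t = a | t = b].
Proof.
move=> /andP[]; rewrite le_eqVlt => /orP[/eqP ->|at_]; first by constructor 2.
rewrite le_eqVlt => /orP[/eqP ->|tb]; first by constructor 3.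
by constructor 1; rewrite at_ tb.
Qed.

Lemma edge_point_in i t : lo i < t < hi i -> edge_point i t = (Some i, param i t).
Proof. by rewrite /edge_point => ->. Qed.
Lemma edge_point_lo i : edge_point i (lo i) = vpt (lo_vtx i).
Proof. by rewrite /edge_point ltxx. Qed.
Lemma edge_point_hi i : edge_point i (hi i) = vpt (hi_vtx i).
Proof. by rewrite /edge_point ltxx andbF. Qed.

Lemma coord_same i t : lo i <= t <= hi i -> coord i (edge_point i t) = t.
Proof.
move=> ht; case: (itv_ends ht) => [ti|->|->].
- rewrite edge_point_in // /coord /= eqxx.
  case: xgetP => [s _ [/= si es]|/(_ t) []]; last by [].
  have /andP[s1 s2] := si.
  by apply: (param_inj (i := i)) => //; rewrite in_itv /= ?ht // !ltW.
- by rewrite edge_point_lo /coord /= side_lo.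
- by rewrite edge_point_hi /coord /= side_hi.
Qed.

Lemma coord_diff i j t : j != i -> lo j <= t <= hi j ->
  coord i (edge_point j t) = side i (param j (lo j)).
Proof.
move=> ji ht; case: (itv_ends ht) => [ti|->|->].
- by rewrite edge_point_in // /coord /= (negPf ji).
- by rewrite edge_point_lo.
- by rewrite edge_point_hi /coord /= side_edge.
Qed.

Variant network_spec z : Prop :=
| NetVertex v of z = vpt v
| NetEdge i t of lo i < t < hi i & z = edge_point i t.

Lemma networkP z : network_set z -> network_spec z.
Proof.
case: z => -[i|] q /=; rewrite /network_set /=; last first.
  by move=> qV; apply: (@NetVertex _ [` qV]%fset).
case=> t /=; rewrite in_itv /= => ti <-.
by apply: (@NetEdge _ i t) => //; rewrite edge_point_in.
Qed.

Lemma edge_point_network i t : lo i <= t <= hi i -> network_set (edge_point i t).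
Proof.
move=> ht; case: (itv_ends ht) => [ti|->|->].
- by rewrite edge_point_in //=; exists t; rewrite //= in_itv.
- by rewrite edge_point_lo /network_set /= param_vertex //; left.
- by rewrite edge_point_hi /network_set /= param_vertex //; right.
Qed.

(** Induction along a walk from an end of edge [i], where the second alternative holds trivially.
    Crossing an edge other than [i] and [j] changes neither side. Crossing [i] leads to an end of
    [i], which lies on the side of [j] facing [i]; crossing [j] is symmetric. *)
Lemma side_compat i j v : i != j ->
  side i (val v) = side i (param j (lo j)) \/ side j (val v) = side j (param i (lo i)).
Proof.
move=> ij; have /connectP[p] := hG.1.2 (lo_vtx i) v.
elim/last_ind: p v => [|p v' IH] v /=; first by move=> _ ->; right.
rewrite rcons_path last_rcons => /andP[/IH/(_ erefl) h /existsP[k ek]] ->.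
set u := last _ _ in h ek.
have in_k (m : E) : edge m = [fset val u; val v']%fset ->
    val v' = param m (lo m) \/ val v' = param m (hi m).
  move=> em; have: val v' \in edge m by rewrite em !inE eqxx orbT.
  by rewrite param_ends !inE => /orP[]/eqP ->; [left|right].
have [ki|ki] := eqVneq k i.
  right; subst k; case: (in_k _ (eqP ek)) => -> //.
  exact: side_edge.
have [kj|kj] := eqVneq k j.
  left; subst k; case: (in_k _ (eqP ek)) => -> //.
  by apply: side_edge; rewrite eq_sym.
have sd m : k != m -> side m (val v') = side m (val u).
  by move=> km; apply/esym/side_adj/existsP; exists k; rewrite km.
by rewrite !sd.
Qed.

Lemma coord_compat i j : i != j -> exists a b, forall z, network_set z ->
  coord i z = a \/ coord j z = b.
Proof.
move=> ij; exists (side i (param j (lo j))), (side j (param i (lo i))) => z /networkP.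
case=> [v ->|k t tk ->]; first exact: side_compat.
have tk' : lo k <= t <= hi k by case/andP: tk => *; rewrite !ltW.
have [ki|ki] := eqVneq k i.
  by subst k; right; rewrite coord_diff.
have [kj|kj] := eqVneq k j.
  by subst k; left; rewrite coord_diff // eq_sym.
by rewrite !coord_diff //; apply: (side_compat (lo_vtx k)).
Qed.

(** * The l1 distance of the coordinate vectors and its four-point inequality *)

Definition rho (z z' : labelled_point G) : R := \sum_(i : E) `|coord i z - coord i z'|.

Lemma rho_xx z : rho z z = 0.
Proof. by rewrite /rho big1 // => i _; rewrite subrr normr0. Qed.

Lemma rhoC z z' : rho z z' = rho z' z.
Proof. by apply: eq_bigr => i _; rewrite distrC. Qed.

Lemma rho_tri z1 z2 z3 : rho z1 z3 <= rho z1 z2 + rho z2 z3.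
Proof. by rewrite /rho -big_split ler_sum // => i _; exact: ler_distD. Qed.

Lemma rho_edge i s t : lo i <= s <= hi i -> lo i <= t <= hi i ->
  rho (edge_point i s) (edge_point i t) = `|s - t|.
Proof.
move=> hs ht; rewrite /rho (bigD1 i) //= !coord_same // big1 ?addr0 // => j ji.
by rewrite !coord_diff 1?eq_sym // subrr normr0.
Qed.

Lemma sum_gt0_exists (f : E -> R) : 0 < \sum_i f i -> exists i, 0 < f i.
Proof.
move=> h; apply/existsP; apply: contraT; rewrite negb_exists => /forallP n.
move: h; rewrite ltNge sumr_le0 // => i _; by rewrite leNgt.
Qed.

(** If [a] occurred both among [x], [z] and among [y], [t], the triangle inequality through [a]
    would refute the strict inequality. In the four-point argument the pair that avoids [a] in one
    coordinate is then forced to have equal values in the other coordinate. *)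
Lemma split_line (x y z t a : R) : `|x - z| + `|y - t| < `|x - y| + `|z - t| ->
  (x != a /\ z != a) \/ (y != a /\ t != a).
Proof.
move=> h; have [[xa za]|n] := pselect (x != a /\ z != a); first by left.
have [[ya ta]|n'] := pselect (y != a /\ t != a); first by right.
have xz : x = a \/ z = a.
  by case: (eqVneq x a) => [|xa]; [left|right; apply/eqP; apply: contra_notT n].
have yt : y = a \/ t = a.
  by case: (eqVneq y a) => [|ya]; [left|right; apply/eqP; apply: contra_notT n'].
have e1 := distrC a; have := ler_distD a z t; have := ler_distD a x y.
move: h; rewrite !e1.
case: xz => ?; case: yt => ?; subst; rewrite ?subrr ?normr0 ?e1; lra.
Qed.

(** Among four points on a line the largest of the three pairing sums is attained twice, so none
    exceeds both others. *)
Lemma line_4pt (x y z t : R) : `|x - z| + `|y - t| < `|x - y| + `|z - t| ->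
  `|x - t| + `|z - y| < `|x - y| + `|z - t| -> False.
Proof.
case: (ger0P (x - z)) => ?; case: (ger0P (y - t)) => ?;
case: (ger0P (x - y)) => ?; case: (ger0P (z - t)) => ?;
case: (ger0P (x - t)) => ?; case: (ger0P (z - y)) => ?; lra.
Qed.

(* In an l1 sum the four-point condition needs the minimal pairing to be the
   same for all coordinates, which is what [coord_compat] provides. *)
Lemma rho_4pt x y z t :
  network_set x -> network_set y -> network_set z -> network_set t ->
  rho x y + rho z t <= Num.max (rho x z + rho y t) (rho x t + rho z y).
Proof.
move=> nx ny nz nt; rewrite leNgt gt_max; apply/negP => /andP[].
rewrite -subr_gt0 -[X in _ -> is_true X -> _]subr_gt0 /rho -!big_split -!sumrB /=.
move=> /sum_gt0_exists[i]; rewrite subr_gt0 => hi' /sum_gt0_exists[j].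
rewrite subr_gt0 => hj.
have [ij|/coord_compat[a [b ab]]] := eqVneq i j.
  by subst j; exact: line_4pt hi' hj.
have {}ab z' : network_set z' -> coord i z' != a -> coord j z' = b.
  by move=> /ab[->|//]; rewrite eqxx.
case: (split_line a hi') => -[/ab h1 /ab h2]; move: hj; rewrite h1 // h2 //.
  by rewrite addrC ltxx.
by rewrite ltxx.
Qed.

(** * Walks and their weights *)

Fixpoint walk z w z' : Prop :=
  if w is g :: w' then
    [/\ valid_segment g, seg_src g = z,
        (w' == [::]) || is_vertex (seg_tgt g) & walk (seg_tgt g) w' z']
  else z = z'.

(** The recursive predicate also admits the empty walk and names the starting point, so that
    induction and concatenation need no special first segment. *)
Lemma walk_is_walk (x y : network G) g w :
  is_walk x y (g :: w) <-> walk (val x) (g :: w) (val y).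
Proof.
have H : forall g w z', [/\ all (@valid_segment R G) (g :: w), path (@joined_at_vertex R G) g w
    & seg_tgt (last g w) = z'] <-> walk (seg_src g) (g :: w) z'.
  move=> {}g {}w z'; elim: w g => [|h w IH] g /=.
    by split=> [[/andP[-> _] _ ->]|[-> _ _ ->]].
  have [IH1 IH2] := IH h; split.
    move=> [/and3P[vg vh aw] /andP[/andP[/eqP e1 e2] pw] l].
    by split=> //; rewrite e1; apply: IH1; rewrite /= vh aw.
  move=> [vg _ vt [vh e c ww]]; have [|av pw l] := IH2; first by split.
  by rewrite vg /joined_at_vertex e eqxx vt; split.
split=> [[a p e l]|/=[vg e c ww]].
  by rewrite -e; apply/H.
by have [|a p l] := (H g w (val y)).2 _; split.
Qed.

Lemma walk_cat z1 w1 z2 w2 z3 : walk z1 w1 z2 -> is_vertex z2 -> walk z2 w2 z3 ->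
  walk z1 (w1 ++ w2) z3.
Proof.
elim: w1 z1 => [|g w1 IH] z1 /=; first by move=> ->.
move=> [vg e c w] v2 ww; split=> //; last exact: IH.
by case: (w1) c w => [|h w'] /= c; [move=> ->; rewrite v2 orbT | rewrite c].
Qed.

Lemma valid_itv g : valid_segment g ->
  [/\ lo (seg_edge g) <= seg_from g <= hi (seg_edge g),
     lo (seg_edge g) <= seg_to g <= hi (seg_edge g) & seg_from g != seg_to g].
Proof. by case/and3P. Qed.

Lemma coord_seg g : valid_segment g ->
  coord (seg_edge g) (seg_src g) = seg_from g /\
  coord (seg_edge g) (seg_tgt g) = seg_to g.
Proof. by move=> /valid_itv[? ? _]; rewrite !coord_same. Qed.

Lemma coord_seg_diff i g : valid_segment g -> i != seg_edge g ->
  coord i (seg_src g) = coord i (seg_tgt g).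
Proof. by move=> /valid_itv[? ? _] ?; rewrite !coord_diff 1?eq_sym. Qed.

Lemma rho_seg g : valid_segment g -> rho (seg_src g) (seg_tgt g) = `|seg_to g - seg_from g|.
Proof. by move=> /valid_itv[? ? _]; rewrite rho_edge // distrC. Qed.

Lemma rho_le_weight z w z' : walk z w z' -> rho z z' <= path_weight w.
Proof.
rewrite /path_weight; elim: w z => [|g w IH] z /=; first by move=> ->; rewrite rho_xx big_nil.
move=> [vg <- _ /IH h]; rewrite big_cons -rho_seg //.
exact: le_trans (rho_tri _ (seg_tgt g) _) (lerD (lexx _) h).
Qed.

Lemma walk_coord_notin i z w z' : walk z w z' -> i \notin map (@seg_edge R G) w ->
  coord i z = coord i z'.
Proof.
elim: w z => [|g w IH] z /=; first by move=> ->.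
by move=> [vg <- _ /IH h]; rewrite inE negb_or => /andP[/(coord_seg_diff vg) -> /h].
Qed.

Lemma walk_coord_in i z w z' : walk z w z' -> uniq (map (@seg_edge R G) w) ->
  i \in map (@seg_edge R G) w -> coord i z != coord i z'.
Proof.
elim: w z => [//|g w IH] z /= [vg <- _ ww] /andP[gw uw].
rewrite inE; have [-> _|ig] := eqVneq i (seg_edge g).
  rewrite -(walk_coord_notin ww gw); case: (coord_seg vg) => -> ->.
  by case: (valid_itv vg).
by move=> /= iw; rewrite (coord_seg_diff vg ig) (IH _ ww).
Qed.

(** With distinct edges each coordinate changes in at most one segment, so the triangle inequality
    along the walk is an equality in every coordinate. *)
Lemma rho_weight z w z' : walk z w z' -> uniq (map (@seg_edge R G) w) ->
  rho z z' = path_weight w.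
Proof.
rewrite /path_weight; elim: w z => [|g w IH] z /=; first by move=> ->; rewrite rho_xx big_nil.
move=> [vg <- _ ww] /andP[gw /(IH _ ww) h]; rewrite big_cons -rho_seg // -h.
rewrite /rho -big_split /=; apply: eq_bigr => i _.
have [->|ig] := eqVneq i (seg_edge g).
  by rewrite -(walk_coord_notin ww gw) subrr normr0 addr0.
by rewrite (coord_seg_diff vg ig) subrr normr0 add0r.
Qed.

(** The witness is the point reached after length [s]. Upper bounds suffice: when the weight is the
    distance of the ends, the triangle inequality turns them into equalities. *)
Lemma walk_point z w z' (s : R) : network_set z -> walk z w z' -> 0 <= s <= path_weight w ->
  exists m, [/\ network_set m, rho z m <= s & rho m z' <= path_weight w - s].
Proof.
rewrite /path_weight; elim: w z s => [|g w IH] z s nz /=.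
  rewrite big_nil => <- /andP[s0 s1]; have -> : s = 0 by lra.
  by exists z; rewrite rho_xx subr0.
rewrite big_cons => -[vg e _ ww] /andP[s0 s1].
have [h1 h2 h3] := valid_itv vg.
have nt : network_set (seg_tgt g) by exact: edge_point_network.
set l := `|_| in s1 *.
have [sl|sl] := leP s l; last first.
  have [|m [nm h4 h5]] := IH _ (s - l) nt ww; first by lra.
  exists m; split=> //; last by lra.
  by have := rho_tri z (seg_tgt g) m; rewrite -{2}e rho_seg // -/l; lra.
have lw := rho_le_weight ww; rewrite /path_weight in lw.
have [k [hk k1 k2]] : exists k, [/\ lo (seg_edge g) <= k <= hi (seg_edge g),
    `|seg_from g - k| <= s & `|k - seg_to g| <= l - s].
  rewrite /l; move: sl; rewrite /l; case: (ger0P (seg_to g - seg_from g)) => d sl.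
    by exists (seg_from g + s); split; rewrite ?ler_norml; lra.
  by exists (seg_from g - s); split; rewrite ?ler_norml; lra.
exists (edge_point (seg_edge g) k); split; first exact: edge_point_network.
  by rewrite -e /seg_src rho_edge.
have := rho_tri (edge_point (seg_edge g) k) (seg_tgt g) z'.
by rewrite {2}/seg_tgt rho_edge //; lra.
Qed.

(** * Existence of paths with distinct edges *)

Lemma adj_segment u v : adjG u v -> u != v -> exists g,
  [/\ valid_segment g, seg_src g = vpt u, seg_tgt g = vpt v &
      edge (seg_edge g) = [fset val u; val v]%fset].
Proof.
move=> /existsP[i /eqP ei] uv.
have lh := lo_lt_hi i; have lh' : lo i != hi i by rewrite lt_eqF.
have in_i v' : val v' \in edge i -> v' = lo_vtx i \/ v' = hi_vtx i.
  by rewrite param_ends !inE => /orP[]/eqP e; [left|right]; exact: val_inj.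
have vg s t : s \in [:: lo i; hi i] -> t \in [:: lo i; hi i] -> s != t ->
    valid_segment ((i, s, t) : segment G).
  rewrite !inE /valid_segment /seg_from /seg_to /seg_edge /=.
  by move=> /orP[]/eqP -> /orP[]/eqP -> ->; rewrite ?lexx !ltW.
have ui : u = lo_vtx i \/ u = hi_vtx i by apply: in_i; rewrite ei !inE eqxx.
have vi : v = lo_vtx i \/ v = hi_vtx i by apply: in_i; rewrite ei !inE eqxx orbT.
case: ui => eu; case: vi => ev; rewrite eu ev ?eqxx // in uv.
  exists (i, lo i, hi i); rewrite /seg_src /seg_tgt /= edge_point_lo edge_point_hi -eu -ev.
  by split=> //; apply: vg; rewrite // !inE eqxx ?orbT.
exists (i, hi i, lo i); rewrite /seg_src /seg_tgt /= edge_point_lo edge_point_hi -eu -ev.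
by split=> //; apply: vg; rewrite // 1?eq_sym // !inE eqxx ?orbT.
Qed.

Lemma vertex_walk u (p : seq V) : path adjG u p -> uniq (u :: p) -> exists w,
  [/\ walk (vpt u) w (vpt (last u p)), map (@seg_tgt R G) w = map vpt p,
      uniq (map (@seg_edge R G) w) &
      forall g q, g \in w -> q \in edge (seg_edge g) -> q \in map val (u :: p)].
Proof.
elim: p u => [|v p IH] u; first by exists [::].
rewrite [path _ _ _]/= [uniq _]/= => /andP[auv /IH{}IH] /andP[uvp /IH[w [ww tw ew sw]]].
have uv : u != v by move: uvp; rewrite inE negb_or => /andP[].
have [g [vg sg tg eg]] := adj_segment auv uv.
exists (g :: w); split=> /=.
- by split=> //; rewrite tg ?orbT.
- by rewrite tw tg.
- rewrite ew andbT; apply/mapP => -[h hw e].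
  have : val u \in map val (v :: p) by apply: sw hw _; rewrite -e eg !inE eqxx.
  by rewrite (mem_map val_inj) (negPf uvp).
- move=> h q; rewrite inE => /orP[/eqP ->|/sw hw /hw]; last
    by rewrite [in X in _ -> X]inE => ->; rewrite orbT.
  by rewrite eg !inE => /orP[]/eqP ->; rewrite eqxx ?orbT.
Qed.

Lemma coord_end i z : z.1 != Some i -> coord i z = lo i \/ coord i z = hi i.
Proof.
have se q : side i q = lo i \/ side i q = hi i by rewrite /side; case: ifP; [left|right].
case: z => -[j|] q /=; rewrite /coord /=; last by move=> _; exact: se.
by have [->|ji _] := eqVneq j i; [rewrite eqxx | exact: se].
Qed.

(** The vertex [v] is [z] itself or the end of its edge that faces [z']. Walks in both directions
    are given because the start as well as the target of a path gets anchored. The equality of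
    coordinates later keeps the path between the two anchors off the edge of [z]. *)
Lemma anchor z z' : network_set z -> (forall i, z.1 = Some i -> z'.1 != Some i) ->
  exists v pre post,
  [/\ walk z pre (vpt v) /\ walk (vpt v) post z,
      [seq y <- z :: map (@seg_tgt R G) pre | is_vertex y] = [:: vpt v],
      [seq y <- map (@seg_tgt R G) post | is_vertex y] = [::],
      map (@seg_edge R G) pre = seq_of_opt z.1 /\ map (@seg_edge R G) post = seq_of_opt z.1 &
      forall i, z.1 = Some i -> coord i (vpt v) = coord i z'].
Proof.
move=> /networkP[v -> _|i t ti ->]; first by exists v, [::], [::].
rewrite edge_point_in //= => /(_ _ erefl) zi.
have [v [e [he ev ce]]] : exists v e, [/\ lo i <= e <= hi i, vpt v = edge_point i e,
    e = coord i z' & t != e].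
  have lh := lo_lt_hi i; have /andP[t1 t2] := ti.
  case: (coord_end zi) => ->.
    by exists (lo_vtx i), (lo i); rewrite edge_point_lo lexx !ltW // gt_eqF.
  by exists (hi_vtx i), (hi i); rewrite edge_point_hi lexx !ltW // lt_eqF.
move=> te; have ti' : lo i <= t <= hi i by case/andP: ti => *; rewrite !ltW.
exists v, [:: (i, t, e)], [:: (i, e, t)]; split.
- rewrite /= /valid_segment /seg_src /seg_tgt /seg_from /seg_to /= ti' he te eq_sym te.
  by rewrite -ev edge_point_in.
- by rewrite /= /seg_tgt /= -ev.
- by rewrite /= /seg_tgt /= edge_point_in.
- by [].
- by move=> _ [<-]; rewrite ev coord_same.
Qed.

Lemma nonoverlapping_uniq w : uniq (map (@seg_edge R G) w) -> pairwise (@nonoverlapping R G) w.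
Proof.
rewrite uniq_pairwise pairwise_map; apply: sub_pairwise => g h /=.
by rewrite /nonoverlapping => /negPf ->.
Qed.

Lemma path_exists (x y : network G) : x != y ->
  exists2 w, is_path x y w & uniq (map (@seg_edge R G) w).
Proof.
move=> xy; have nx := set_valP x; have ny := set_valP y.
have [same|diff] := pselect (exists i, (val x).1 = Some i /\ (val y).1 = Some i).
  have [i [xi yi]] := same.
  case: (networkP nx) => [v e|j s hs ex]; first by rewrite e in xi.
  case: (networkP ny) => [v e|k t ht ey]; first by rewrite e in yi.
  have ej : j = i by move: xi; rewrite ex edge_point_in // => -[].
  have ek : k = i by move: yi; rewrite ey edge_point_in // => -[].
  subst j k; exists [:: (i, s, t)] => //; split=> //.
  - split=> //=; rewrite ?andbT /valid_segment /seg_from /seg_to /=.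
    case/andP: hs => ? ?; case/andP: ht => ? ?; rewrite !ltW //=.
    by apply: contraNneq xy => st; apply/eqP/val_inj; rewrite ex ey st.
  - by rewrite /= /seg_src /seg_tgt /= !edge_point_in.
have dx i : (val x).1 = Some i -> (val y).1 != Some i.
  by move=> xi; apply/eqP => yi; apply: diff; exists i.
have dy i : (val y).1 = Some i -> (val x).1 != Some i.
  by move=> yi; apply/eqP => xi; apply: diff; exists i.
have [u [pre [_ [[wpre _] vpre _ [epre _] cu]]]] := anchor nx dx.
have [v [_ [post [[_ wpost] _ vpost [_ epost] cv]]]] := anchor ny dy.
have /connectP[p0 pp0] := hG.1.2 u v; case/shortenP: pp0 => p pp up _ lp.
have [mid [wmid tmid emid _]] := vertex_walk pp up; rewrite -lp in wmid.
set w := pre ++ mid ++ post.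
have ww : walk (val x) w (val y) by do 2 (apply: walk_cat; [eassumption|by []|]).
have ew : uniq (map (@seg_edge R G) w).
  have ein i : i \in map (@seg_edge R G) mid ->
      (val x).1 != Some i /\ (val y).1 != Some i.
    (* An edge of the vertex path changes its coordinate between the anchors [u] and [v], but in the
       coordinate of the edge carrying [x] or [y] these anchors agree. *)
    move=> im; have := walk_coord_in wmid emid im.
    have [xi|xi] := eqVneq (val x).1 (Some i).
      rewrite (cu _ xi) (walk_coord_notin wpost) ?eqxx // epost.
      by move: (dx _ xi); case: (val y).1 => //= j; rewrite !inE eq_sym.
    have [yi|//] := eqVneq (val y).1 (Some i).
    rewrite (cv _ yi) -(walk_coord_notin wpre) ?eqxx // epre.
    by move: (dy _ yi); case: (val x).1 => //= j; rewrite !inE eq_sym.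
  rewrite !map_cat epre epost !cat_uniq emid has_cat.
  have u1 (o : option E) : uniq (seq_of_opt o) by case: o.
  have in1 (o : option E) i : (i \in seq_of_opt o) = (o == Some i).
    by case: o => //= j; rewrite !inE eq_sym.
  rewrite !u1 /= andbT -!all_predC; apply/andP; split; [apply/norP; split|].
  - by rewrite -all_predC; apply/allP => i /ein[+ _] /=; rewrite in1.
  - by rewrite -all_predC; apply/allP => i; rewrite in1 /= in1 => /eqP/dy.
  - by apply/allP => i; rewrite in1 => yi; apply/negP => /ein[_]; rewrite yi.
exists w => //; split; [|exact: nonoverlapping_uniq|].
- by case: (w) ww => [/val_inj e|g w' /walk_is_walk //]; rewrite e eqxx in xy.
- have -> : walk_vertices w = map vpt (u :: p).
    rewrite -[u :: p]cat1s map_cat [map vpt [:: u]]/= -vpre -tmid.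
    have -> : walk_vertices w = [seq y <- val x :: map (@seg_tgt R G) w | is_vertex y].
      by case: (w) ww => [/val_inj e|g w' /= [_ -> //]]; rewrite e eqxx in xy.
    rewrite /w !map_cat -cat_cons !filter_cat vpost cats0; congr (_ ++ _).
    by rewrite tmid; apply/all_filterP/allP => _ /mapP[v' _ ->].
  by rewrite map_inj_uniq // => a b [] /val_inj.
Qed.

(** Every walk weighs at least the l1 distance of its ends, and a path with distinct edges attains
    it. *)
Lemma dG_rho (x y : network G) : dG x y = rho (val x) (val y).
Proof.
rewrite /dG; case: eqVneq => [->|xy]; first by rewrite rho_xx.
have [w pw uw] := path_exists xy.
have wW w' : is_path x y w' -> walk (val x) w' (val y).
  by case: w' => [[]|g w' [/walk_is_walk]].
set S := [set r | _].
have Sr : S (rho (val x) (val y)) by exists w => //; rewrite (rho_weight (wW _ pw)).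
have lb : lbound S (rho (val x) (val y)).
  by move=> _ [w' pw' ->]; exact: rho_le_weight (wW _ pw').
apply/eqP; rewrite eq_le lb_le_inf ?andbT //; last by exists (rho (val x) (val y)).
by apply: ge_inf => //; exists (rho (val x) (val y)).
Qed.

Lemma dG_xx (x : network G) : dG x x = 0.
Proof. by rewrite dG_rho rho_xx. Qed.

Lemma dGC (x y : network G) : dG x y = dG y x.
Proof. by rewrite !dG_rho rhoC. Qed.

Lemma dG_tri (x y z : network G) : dG x z <= dG x y + dG y z.
Proof. by rewrite !dG_rho rho_tri. Qed.

Lemma dG_gt0 (x y : network G) : x != y -> 0 < dG x y.
Proof.
move=> xy; have [w [ww _ _] uw] := path_exists xy.
case: w ww uw => // g w /walk_is_walk ww uw; rewrite dG_rho (rho_weight ww uw).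
rewrite /path_weight big_cons ltr_pwDl ?sumr_ge0 //.
case: ww => /valid_itv[_ _ ne] _ _ _.
by rewrite normr_gt0 subr_eq0 eq_sym.
Qed.

Lemma dG_4pt (x y z t : network G) :
  dG x y + dG z t <= Num.max (dG x z + dG y t) (dG x t + dG z y).
Proof. by rewrite !dG_rho; apply: rho_4pt; exact: set_valP. Qed.

Lemma dG_mid (x y : network G) : exists m, dG x m = dG x y / 2 /\ dG m y = dG x y / 2.
Proof.
have [->|xy] := eqVneq x y; first by exists y; rewrite dG_xx mul0r.
have [w [ww _ _] uw] := path_exists xy; case: w ww uw => // g w /walk_is_walk ww uw.
have hw := rho_weight ww uw; have d0 := dG_gt0 xy; rewrite dG_rho hw in d0.
have [|m [nm h1 h2]] := walk_point (s := path_weight (g :: w) / 2) (set_valP x) ww.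
  by lra.
pose m' : network G := SigSub (mem_set nm).
have e : val m' = m by [].
exists m'; have := rho_tri (val x) m (val y); rewrite !dG_rho hw e; lra.
Qed.

End Tree.

(** * The Delaunay relation on a tree *)

Section ThreePoints.
Variables (K : choiceType) (a b c : K).
Local Open Scope fset_scope.

Lemma fset3P x : reflect [\/ x = a, x = b | x = c] (x \in [fset a; b; c]).
Proof.
rewrite !inE -orbA; apply: (iffP or3P) => -[].
- by move/eqP ->; constructor 1.
- by move/eqP ->; constructor 2.
- by move/eqP ->; constructor 3.
- by move=> ->; constructor 1.
- by move=> ->; constructor 2.
- by move=> ->; constructor 3.
Qed.

Lemma fset3_sub (X : {fset K}) : a \in X -> b \in X -> c \in X -> [fset a; b; c] `<=` X.
Proof. by move=> aX bX cX; apply/fsubsetP => x /fset3P[] ->. Qed.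

End ThreePoints.

Lemma fset_argmin (R : realType) (K : choiceType) (X : {fset K}) (P : K -> Prop)
    (f : K -> R) z0 : z0 \in X -> P z0 ->
  exists z, [/\ z \in X, P z & forall w, w \in X -> P w -> f z <= f w].
Proof.
move=> z0X Pz0; pose Q (v : X) := `[< P (val v) >].
have Q0 : Q [` z0X]%fset by apply/asboolP.
have [v /asboolP Pv vmin] := arg_minP (fun v : X => f (val v)) Q0.
exists (val v); split=> // [|w wX Pw]; first exact: valP.
by apply: (vmin [` wX]%fset); apply/asboolP.
Qed.

Section Delaunay.
Variables (R : realType) (G : euclidean_graph R).
Hypothesis hG : is_tree G.
Implicit Types (X Y : config G) (a b c u w x y z : network G).
Local Open Scope fset_scope.

Lemma general_position_sub X Y : Y `<=` X -> general_position X -> general_position Y.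
Proof.
move=> /fsubsetP YX gX [c [r [x [y [z [r0 [xY yY zY] ? ?]]]]]]; apply: gX.
by exists c, r, x, y, z; split=> //; split; exact: YX.
Qed.

Lemma in_neighbours u X x : (x \in neighbours [fset u] X) = `[< delaunay X x u >].
Proof.
rewrite !inE; apply/idP/asboolP => [/andP[_ /asboolP[z]]|d].
  by rewrite inE => /eqP ->.
by case: (d) => -> _ _ /=; apply/asboolP; exists u => //; rewrite inE.
Qed.

(** A common point [m] of the cells is equidistant from [a] and [b] and at least as far from [w], so
    the four-point inequality for [m], [w], [a], [b] reduces to the bound on [dG a b]. Conversely
    the midpoint lies in both cells: a [w] nearer to it than half of [dG a b] would be closer than
    [dG a b] to both ends. *)
Lemma delaunayP X a b : delaunay X a b <->
  [/\ a \in X, b \in X & forall w, w \in X -> dG a b <= Num.max (dG a w) (dG b w)].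
Proof.
split=> [[aX bX [m [ma mb]]]|[aX bX h]].
  split=> // w wX; have := dG_4pt hG m w a b.
  have := ma _ wX; have := mb _ wX; have := ma _ bX; have := mb _ aX.
  rewrite !le_max [dG w b](dGC hG) [dG a w](dGC hG) => e1 e2 e3 e4.
  by move=> /orP[] ?; apply/orP; [right|left]; lra.
have [m [am mb]] := dG_mid hG a b; rewrite (dGC hG) in am.
split=> //; exists m; split=> w wX /=; rewrite ?am ?mb.
  have := h _ wX; have := dG_tri hG a m w; have := dG_tri hG b m w.
  by rewrite le_max ![dG _ m](dGC hG) am mb => ? ? /orP[] ?; lra.
have := h _ wX; have := dG_tri hG a m w; have := dG_tri hG b m w.
by rewrite le_max ![dG _ m](dGC hG) am mb => ? ? /orP[] ?; lra.
Qed.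

Lemma not_delaunay X a b : a \in X -> b \in X -> ~ delaunay X a b ->
  exists2 w, w \in X & dG a w < dG a b /\ dG b w < dG a b.
Proof.
move=> aX bX /delaunayP n; apply: contrapT => n'; apply: n; split=> // w wX.
rewrite leNgt gt_max; apply/negP => /andP[? ?]; apply: n'.
by exists w.
Qed.

Lemma delaunay_sym X a b : delaunay X a b -> delaunay X b a.
Proof. by case=> aX bX [m [ma mb]]; split=> //; exists m; split. Qed.

Lemma delaunay_sub X Y a b : Y `<=` X -> a \in Y -> b \in Y ->
  delaunay X a b -> delaunay Y a b.
Proof.
move=> /fsubsetP YX aY bY [_ _ [m [ma mb]]]; split=> //; exists m.
by split=> w /YX; [exact: ma|exact: mb].
Qed.

Lemma delaunay_refl X a : a \in X -> delaunay X a a.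
Proof.
move=> aX; apply/delaunayP; split=> // w _; rewrite (dG_xx hG) le_max.
have [->|aw] := eqVneq a w; first by rewrite (dG_xx hG) lexx.
by rewrite ltW // (dG_gt0 hG).
Qed.

(** Each of the three distances is at most the larger of the other two, so the two longest agree.
    The sphere about the midpoint of a longest side through its ends then contains the third point,
    against general position. *)
Lemma delaunay_no_triangle X a b c : general_position X ->
  a != b -> b != c -> a != c ->
  delaunay X a b -> delaunay X b c -> delaunay X a c -> False.
Proof.
have far a' b' c' : delaunay X a' b' -> a' != b' -> b' != c' -> a' != c' ->
    c' \in X -> dG a' b' = dG a' c' -> dG b' c' <= dG a' b' -> general_position X -> False.
  move=> [aX bX _] ab bc ac cX e le; apply.
  have [m [am mb]] := dG_mid hG a' b'; rewrite (dGC hG) in am.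
  exists m, (dG a' b' / 2), a', b', c'; split=> //.
    by have := dG_gt0 hG ab; lra.
  split=> //; apply/eqP; rewrite eq_le; apply/andP; split.
    have := dG_4pt hG m c' a' b'; rewrite am mb [dG a' c'](dGC hG).
    by rewrite [dG c' b'](dGC hG) [dG c' a'](dGC hG) -e le_max => /orP[]; lra.
  by have := dG_tri hG a' m c'; rewrite [dG a' m](dGC hG); lra.
move=> gX ab bc ac dab dbc dac.
have [aX bX hab] := (delaunayP _ _ _).1 dab.
have [_ cX hbc] := (delaunayP _ _ _).1 dbc.
have [_ _ hac] := (delaunayP _ _ _).1 dac.
have := hab _ cX; have := hbc _ aX; have := hac _ bX.
rewrite ![dG c _](dGC hG) ![dG b a](dGC hG) !le_max.
set AB := dG a b; set BC := dG b c; set AC := dG a c.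
move=> h1 h2 h3; have [e|[e|e]] : (AB = AC /\ BC <= AB) \/ (AB = BC /\ AC <= AB)
    \/ (AC = BC /\ AB <= AC).
  case/orP: h3 => h3; case/orP: h1 => h1; case/orP: h2 => h2.
  - by left; split; lra.
  - by left; split; lra.
  - by left; split; lra.
  - by right; right; split; lra.
  - by right; left; split; lra.
  - by left; split; lra.
  - by right; left; split; lra.
  - by right; right; split; lra.
- exact: (far a b c dab ab bc ac cX e.1 e.2 gX).
- apply: (far b a c (delaunay_sym dab) _ ac bc cX _ _ gX); rewrite 1?eq_sym //.
    by rewrite [dG b a](dGC hG); case: e.
  by rewrite [dG b a](dGC hG); case: e.
- apply: (far c a b (delaunay_sym dac) _ ab _ bX _ _ gX); rewrite 1?eq_sym // ![dG c _](dGC hG).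
    by case: e.
  by case: e.
Qed.

(** Only [u] can be what blocks [a], [b] anew. A [z] blocking [a], [u] would be nearer to [a] than
    [b] is, and by the four-point inequality nearer to [b] than [a] is, so it would block [a], [b]
    already in [X]. With symmetry, adding [u] destroys relations only among its neighbours. *)
Lemma delaunay_lost X u a b : delaunay X a b -> ~ delaunay (u |` X) a b ->
  delaunay (u |` X) a u.
Proof.
move=> /delaunayP[aX bX h] /not_delaunay[||w]; try exact: fset1Ur.
case/fset1UP => [-> [h1 h2]|wX [h1 h2]]; last first.
  by have := h _ wX; rewrite leNgt gt_max h1 h2.
apply/delaunayP; split=> [||z /fset1UP[->|zX]].
- exact: fset1Ur.
- exact: fset1U1.
- by rewrite le_max lexx.
rewrite leNgt gt_max; apply/negP => /andP[h3 h4].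
have := h _ zX; have := dG_4pt hG b z a u.
rewrite [dG b a](dGC hG) [dG a z](dGC hG) [dG u z](dGC hG) in h3 h4 *.
by rewrite !le_max => /orP[] ? /orP[] ?; lra.
Qed.

(** * The neighbours of an added point *)

Definition nbrs u X : config G := neighbours [fset u] (u |` X) `&` X.

Lemma nbrsP u X x : reflect (x \in X /\ delaunay (u |` X) x u) (x \in nbrs u X).
Proof.
rewrite /nbrs in_fsetI in_neighbours; apply: (iffP andP) => [[/asboolP ? ?]|[? ?]] //.
by split=> //; apply/asboolP.
Qed.

Lemma nbrs_sub u X : nbrs u X `<=` X.
Proof. exact: fsubsetIr. Qed.

Lemma neighbours_nbrs u X x : x \in neighbours [fset u] (u |` X) ->
  x = u \/ x \in nbrs u X.
Proof.
move=> xN; have : x \in u |` X by move: xN; rewrite in_neighbours => /asboolP[].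
by move=> /fset1UP[|xX]; [left|right; rewrite /nbrs in_fsetI xN].
Qed.

Lemma neighboursE u X : neighbours [fset u] (u |` X) = u |` nbrs u X.
Proof.
apply/fsetP => x; apply/idP/idP => [/neighbours_nbrs[->|xY]|].
- exact: fset1U1.
- exact: fset1Ur.
rewrite in_neighbours => /fset1UP[->|/nbrsP[_ d]]; apply/asboolP => //.
by apply: delaunay_refl; exact: fset1U1.
Qed.

Lemma nbrs_idem u X : nbrs u (nbrs u X) = nbrs u X.
Proof.
apply/fsetP => x; apply/idP/idP => [/(fsubsetP (nbrs_sub _ _))//|xY].
apply/nbrsP; split=> //; have [xX d] := nbrsP _ _ _ xY.
apply: delaunay_sub d; [|exact: fset1Ur|exact: fset1U1].
by apply: fsetUS; exact: nbrs_sub.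
Qed.

(* If [z] blocks the pair [a], [b] in [X], then so does the blocking point
   nearest to [u], which is adjacent to [u]. *)
Lemma delaunay_nbrs X u a b : u \notin X -> general_position (u |` X) ->
  a \in nbrs u X -> b \in nbrs u X ->
  delaunay (nbrs u X) a b -> delaunay X a b.
Proof.
move=> uX gX aY bY dY; have [aX au] := nbrsP _ _ _ aY; have [bX bu] := nbrsP _ _ _ bY.
have [<-|ab] := eqVneq a b; first exact: delaunay_refl.
have [ua ub] : u != a /\ u != b by split; apply: contraNneq uX => ->.
apply: contrapT => /(not_delaunay aX bX) [z0 z0X z0lt].
(* The relations of [u] to [a] and [b] persist among these three points, where a third relation
   would complete a triangle. So [a], [b] are blocked there, and only [u] can block them. *)
have [ula ulb] : dG a u < dG a b /\ dG b u < dG a b.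
  have [aS bS uS] : [/\ a \in [fset a; b; u], b \in [fset a; b; u] & u \in [fset a; b; u]].
    by split; apply/fset3P; [constructor 1|constructor 2|constructor 3].
  have : ~ delaunay [fset a; b; u] a b.
    have sub : [fset a; b; u] `<=` u |` X.
      by case: (au) (bu) => ? ? _ [? _ _]; exact: fset3_sub.
    have bu' := delaunay_sub sub bS uS bu; have au' := delaunay_sub sub aS uS au.
    rewrite eq_sym in ua; rewrite eq_sym in ub => d.
    exact: delaunay_no_triangle (general_position_sub sub gX) ab ub ua d bu' au'.
  move=> /(not_delaunay aS bS)[w] /fset3P[] -> // [].
    by rewrite (dG_xx hG) [dG b a](dGC hG) ltxx.
  by rewrite ltxx.
have [z [zX [za zb] zmin]] :=
  fset_argmin (P := fun w => dG a w < dG a b /\ dG b w < dG a b) (dG u) z0X z0lt.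
have zY : z \in nbrs u X.
  apply/nbrsP; split=> //; apply/delaunayP; split=> [||w /fset1UP[->|wX]].
  - exact: fset1Ur.
  - exact: fset1U1.
  - by rewrite le_max lexx.
  (* A [w] blocking [z], [u] is nearer to [u] than [z] is. As [u] itself is close to [a] and [b],
     the four-point inequality makes [w] block [a], [b] too, against the choice of [z]. *)
  rewrite leNgt gt_max; apply/negP => /andP[h1 h2].
  have : dG u z <= dG u w; last by rewrite [dG u z](dGC hG); lra.
  apply: zmin => //; split.
    have := dG_4pt hG a w z u; rewrite [dG w u](dGC hG) le_max => /orP[] ?; lra.
  have := dG_4pt hG b w z u; rewrite [dG w u](dGC hG) le_max => /orP[] ?; lra.
have [_ _ /(_ _ zY)] := (delaunayP _ _ _).1 dY.
by rewrite leNgt gt_max za zb.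
Qed.

(** Before [u] is added, a pair of its neighbours is blocked in [X] only if it is blocked by another
    neighbour. Once [u] is present, two distinct neighbours of [u] in [X] are related in neither
    configuration, since they would form a triangle with [u]. *)
Lemma same_local_data_nbrs X u : u \notin X -> general_position (u |` X) ->
  same_local_data u X (nbrs u X).
Proof.
move=> uX gX; have Yu : u |` nbrs u X `<=` u |` X by apply: fsetUS; exact: nbrs_sub.
split; first by rewrite -/(nbrs u X) -/(nbrs u (nbrs u X)) nbrs_idem.
  have uY : u \notin nbrs u X by apply: contra uX => /(fsubsetP (nbrs_sub _ _)).
  move=> a b /neighbours_nbrs[->|aY] /neighbours_nbrs[->|bY].
  - by split=> -[h]; [rewrite h in uX|rewrite h in uY].
  - by split=> -[h]; [rewrite h in uX|rewrite h in uY].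
  - by split=> -[_ h]; [rewrite h in uX|rewrite h in uY].
  - split; last exact: delaunay_nbrs.
    by apply: delaunay_sub => //; exact: nbrs_sub.
move=> a b aN bN.
have [au bu] : delaunay (u |` X) a u /\ delaunay (u |` X) b u.
  by move: aN bN; rewrite !in_neighbours => /asboolP ? /asboolP.
have inY c : c \in neighbours [fset u] (u |` X) -> c \in u |` nbrs u X.
  by move=> /neighbours_nbrs[->|cY]; [exact: fset1U1|exact: fset1Ur].
split=> [|d]; first by apply: delaunay_sub => //; exact: inY.
have [<-|ab] := eqVneq a b; first by apply: delaunay_refl; case: au.
have [ea|na] := eqVneq a u; first by rewrite ea; exact: delaunay_sym.
have [eb|nb] := eqVneq b u; first by rewrite eb.
exfalso; apply: (delaunay_no_triangle (general_position_sub Yu gX) ab nb na d);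
  by apply: delaunay_sub (Yu) _ _ _ => //; [exact: inY|exact: fset1U1].
Qed.

End Delaunay.

(** * Measurability of the potential *)

Section Measurability.
Variables (R : realType) (G : euclidean_graph R).
Notation E := 'I_(nedges G).
Notation configT := (g_sigma_algebraType (@count_events R G)).
Implicit Types (B : set (network G)) (i : E).

Definition edge_trace i B : set R :=
  [set t | lo i < t < hi i /\ exists2 z, B z & val z = (Some i, param i t)].

(** Injectivity of the parametrization makes the witness set unique, so measurability concerns one
    canonical set of parameters on each edge. *)
Lemma network_measurableP B : network_measurable B <-> forall i, measurable (edge_trace i B).
Proof.
split=> h i.
  have [A [mA AI e]] := h i; suff -> : edge_trace i B = A by [].
  apply/seteqP; split=> t.
    move=> [ti zB]; have : (param i @` A) (param i t) by rewrite -e.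
    case=> s As st; suff <- : s = t by [].
    have := AI _ As; rewrite /= in_itv /= => si.
    by apply: (param_inj (i := i)) => //; rewrite in_itv /=; apply/andP; split; apply: ltW;
      [case/andP: si|case/andP: si|case/andP: ti|case/andP: ti].
  move=> At; have ti := AI _ At; split; first by move: ti; rewrite /= in_itv.
  have : (param i @` A) (param i t) by exists t.
  by rewrite -e.
exists (edge_trace i B); split=> //; first by move=> t [ti _]; rewrite /= in_itv.
apply/seteqP; split=> [q [z Bz zq]|_ [t [ti [z Bz zt]] <-]]; last by exists z.
have : network_set (val z) by exact: set_valP.
rewrite zq => -[t /= ti tq]; exists t => //; split; first by rewrite in_itv in ti.
by exists z => //; rewrite tq.
Qed.

Lemma network_measurable_sigma : sigma_algebra setT (@network_measurable R G).
Proof.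
split=> [|B /network_measurableP mB|B mB]; apply/network_measurableP => i.
- suff -> : edge_trace i set0 = set0 by [].
  by rewrite predeqE => t; split=> // -[_ [z]].
- have -> : edge_trace i (setT `\` B) = `]lo i, hi i[ `\` edge_trace i B; last exact: measurableD.
  apply/seteqP; split=> t.
    move=> [ti [z [_ nB] zt]]; split; first by rewrite /= in_itv.
    by move=> [_ [z' Bz' zt']]; apply: nB; have -> : z = z' by apply: val_inj; rewrite zt zt'.
  move=> [ti nt]; rewrite /= in_itv /= in ti; split=> //.
  have nz : network_set ((Some i, param i t) : labelled_point G) by exists t; rewrite //= in_itv.
  exists (SigSub (mem_set nz) : network G) => //; split=> // Bz; apply: nt; split=> //.
  by exists (SigSub (mem_set nz) : network G).
- have -> : edge_trace i (\bigcup_k B k) = \bigcup_k edge_trace i (B k).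
    apply/seteqP; split=> t.
      by move=> [ti [z [k _ Bz] zt]]; exists k => //; split=> //; exists z.
    by move=> [k _ [ti [z Bz zt]]]; split=> //; exists z => //; exists k.
  by apply: bigcup_measurable => k _; have /network_measurableP := mB k.
Qed.

Lemma npoints_eq0 B (X : config G) : (npoints B X == 0)%N = all (fun x => x \notin B) X.
Proof.
rewrite cardfs_eq0; apply/eqP/allP => [e x xX|h].
  apply/negP => xB; have : x \in [fset z in X | z \in B]%fset by rewrite !inE xX.
  by rewrite e in_fset0.
by apply/fsetP => x; rewrite !inE; apply/negP => /andP[/h /negP].
Qed.

Lemma measurable_npoints B k : network_measurable B ->
  (measurable : set (set configT)) [set X | npoints B X = k].
Proof. by move=> mB; apply: sub_sigma_algebra; exists B, k. Qed.

Lemma npoints1 B x : npoints B [fset x]%fset = (x \in B).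
Proof.
rewrite /npoints; case: (boolP (x \in B)) => xB.
  suff -> : [fset z in [fset x] | z \in B]%fset = [fset x]%fset by rewrite cardfs1.
  by apply/fsetP => z; rewrite !inE; case: eqVneq => //= ->.
suff -> : [fset z in [fset x] | z \in B]%fset = fset0 by rewrite cardfs0.
by apply/fsetP => z; rewrite !inE; case: eqVneq => //= ->; apply: negPf.
Qed.

(** The sets of configurations with measurable trace on singletons form a sigma-algebra. It contains
    the count events, since a single point has count 0 or 1, and hence all that they generate. *)
Lemma measurable_singleton (S : set (config G)) :
  (measurable : set (set configT)) S -> network_measurable [set x | S [fset x]%fset].
Proof.
have [n0 nD nU] := network_measurable_sigma.
move=> /(_ [set S | network_measurable [set x | S [fset x]%fset]]); apply; split.
  split=> [|A|A] /=; [exact: n0| exact: nD | exact: nU].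
have nT : network_measurable (@setT (network G)) by have := nD _ n0; rewrite setD0.
move=> _ [B [k [mB ->]]] /=.
have [->|k1] := eqVneq k 1%N.
  rewrite (_ : [set x | _] = B) //; apply/seteqP; split=> x /=; rewrite npoints1.
    by case: (boolP (x \in B)) => // /set_mem.
  by move=> Bx; rewrite mem_set.
have [->|k0] := eqVneq k 0%N.
  rewrite (_ : [set x | _] = setT `\` B); first exact: nD.
  apply/seteqP; split=> x /=; rewrite npoints1.
    by case: (boolP (x \in B)) => // xB _; split=> // /mem_set; exact/negP.
  by move=> [_ nB]; rewrite memNset.
rewrite (_ : [set x | _] = set0) //; apply/seteqP; split=> x //=; rewrite npoints1.
by case: (x \in B) => /= e; rewrite -e eqxx in k0 k1.
Qed.

(* The maximum and the minimum of [f] over a configuration are measurable since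
   their level sets are given by counts; on two points their product is that of
   the values of [f]. *)
Definition max_over (f : network G -> R) (X : config G) : R :=
  foldr (fun x m => Num.max (f x) m) 0 X.
(** Starting from the maximum leaves the minimum over a nonempty configuration unchanged, which a
    start at 0 would not. *)
Definition min_over (f : network G -> R) (X : config G) : R :=
  foldr (fun x m => Num.min (f x) m) (max_over f X) X.

Variable f : network G -> R.
Hypothesis f_ge0 : forall x, 0 <= f x.
Hypothesis f_meas : forall a, network_measurable [set x | a < f x].

Lemma max_over_ge0 X : 0 <= max_over f X.
Proof. by rewrite /max_over; elim: (enum_fset X) => //= x s IH; rewrite le_max IH orbT. Qed.

Lemma min_over_ge0 X : 0 <= min_over f X.
Proof.
rewrite /min_over; elim: (enum_fset X) => [|x s IH] /=; first exact: max_over_ge0.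
by rewrite le_min f_ge0.
Qed.

Lemma measurable_max_over : measurable_fun setT (max_over f : configT -> R).
Proof.
move=> _; apply: (measurability _ (RGenOInfty.measurableE R)) => //.
move=> /= _ [_ [a ->] <-]; rewrite setTI.
have maxP s : (a < foldr (fun x m => Num.max (f x) m) 0 s) = (a < 0) || has (fun x => a < f x) s.
  by elim: s => [|x s IH] /=; rewrite ?orbF // lt_max IH orbCA.
rewrite [X in measurable X](_ : _ =
  if a < 0 then setT else ~` [set X | npoints [set x | a < f x] X = 0%N]).
  by case: ifP => // _; apply: measurableC; exact: measurable_npoints.
apply/seteqP; split=> X; rewrite /= in_itv /= andbT maxP; case: ifP => //= _.
  move=> /hasP[x xX ax] /eqP; rewrite npoints_eq0 => /allP /(_ _ xX) /negP; apply.
  exact: mem_set.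
move=> /eqP; rewrite npoints_eq0 => /allPn[x xX]; rewrite negbK => /set_mem /= ax.
by apply/hasP; exists x.
Qed.

Lemma measurable_min_over : measurable_fun setT (min_over f : configT -> R).
Proof.
move=> _; apply: (measurability _ (RGenOInfty.measurableE R)) => //.
move=> /= _ [_ [a ->] <-]; rewrite setTI.
have minP m s : (a < foldr (fun x m => Num.min (f x) m) m s) = (a < m) && all (fun x => a < f x) s.
  by elim: s => [|x s IH] /=; rewrite ?andbT // lt_min IH andbCA.
rewrite [X in measurable X](_ : _ = (max_over f : configT -> R) @^-1` `]a, +oo[ `&`
    [set X | npoints (setT `\` [set x | a < f x]) X = 0%N]).
  apply: measurableI; first by rewrite -[X in measurable X]setTI; exact: measurable_max_over.
  by apply: measurable_npoints; have [_ nD _] := network_measurable_sigma; exact: nD.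
apply/seteqP; split=> X; rewrite /= !in_itv /= !andbT minP.
  move=> /andP[-> /allP h]; split=> //; apply/eqP; rewrite npoints_eq0; apply/allP => x xX.
  by apply/negP => /set_mem[_] /=; rewrite h.
move=> [-> /eqP]; rewrite npoints_eq0 => /allP h; apply/allP => x xX.
by apply: contraT => nx; move/negP: (h _ xX); case; apply: mem_set; split=> //; exact/negP.
Qed.

Lemma max_min_over (X : config G) : #|` X| = 2%N ->
  max_over f X * min_over f X = \prod_(x <- X) f x.
Proof.
rewrite /min_over /max_over; case: (enum_fset X) => [|x [|y [|? ?]]] //= _.
rewrite !big_cons big_nil mulr1 ![Num.max (f y) 0]max_l //.
case: (leP (f x) (f y)) => xy.
  by rewrite minxx (min_l xy) mulrC.
by rewrite (min_l (ltW xy)) (min_r (ltW xy)).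
Qed.
End Measurability.

Section Potential.
Variables (R : realType) (G : euclidean_graph R) (p : config G -> R).
Notation configT := (g_sigma_algebraType (@count_events R G)).
Hypothesis mp : config_measurable p.
Hypothesis p_ge0 : forall X, 0 <= p X.

(* On three or more points only the positivity of the potential matters. *)
Definition potential (X : config G) : R :=
  if #|` X| == 0%N then 1
  else if #|` X| == 1%N then p X / p fset0
  else if #|` X| == 2%N then p X * p fset0 / \prod_(x <- X) p [fset x]%fset
  else if 0 < p X then 1 else 0.

Lemma potential_ge0 X : 0 <= potential X.
Proof.
rewrite /potential; case: ifP => // _; case: ifP => _; first by rewrite divr_ge0.
case: ifP => _; last by case: ifP.
by rewrite divr_ge0 ?mulr_ge0 // prodr_ge0.
Qed.

Lemma measurable_potential : config_measurable potential.
Proof.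
pose f (x : network G) := p [fset x]%fset.
have f0 x : 0 <= f x by exact: p_ge0.
have fm a : network_measurable [set x | a < f x].
  rewrite (_ : [set x | _] = [set x | ((p : configT -> R) @^-1` `]a, +oo[) [fset x]%fset]).
    by apply: measurable_singleton; rewrite -[X in measurable X]setTI; exact: mp.
  by apply/seteqP; split=> x /=; rewrite in_itv /= andbT.
pose D (X : configT) := max_over f X * min_over f X.
have mD : measurable_fun setT (fun X => (D X)^-1).
  (* On nonnegative reals, 0 included, inversion is the power with exponent -1, which is
     measurable. *)
  rewrite (_ : (fun X => _) = (@powR R ^~ (-1)) \o D).
    apply: measurableT_comp; first exact: measurable_powR.
    by apply: measurable_funM; [exact: measurable_max_over|exact: measurable_min_over].
  by apply/funext => X /=; rewrite powR_inv1 // mulr_ge0 ?max_over_ge0 ?min_over_ge0.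
have msize k : measurable_fun setT ((fun X => #|` X| == k) : configT -> bool).
  apply: (measurable_fun_bool true); rewrite setTI.
  rewrite (_ : _ @^-1` _ = [set X | npoints setT X = k]).
    apply: measurable_npoints; have [n0 nD _] := network_measurable_sigma G.
    by have := nD _ n0; rewrite setD0.
  have nT (X : config G) : npoints setT X = #|` X|.
    by rewrite /npoints; congr #|` _|; apply/fsetP => x; rewrite !inE in_setT andbT.
  by apply/seteqP; split=> X /=; rewrite nT => /eqP.
rewrite /config_measurable (_ : potential = fun X =>
  if #|` X| == 0%N then 1
  else if #|` X| == 1%N then p X / p fset0
  else if #|` X| == 2%N then p X * p fset0 * (D X)^-1
  else if 0 < p X then 1 else 0).
  apply: measurable_fun_ifT => //.
  apply: measurable_fun_ifT => //; first exact: measurable_funM.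
  apply: measurable_fun_ifT => //.
    by apply: measurable_funM => //; exact: measurable_funM.
  by apply: measurable_fun_ifT => //; exact: measurable_fun_ltr.
apply/funext => X; rewrite /potential; case: ifP => // _; case: ifP => // _.
by case: ifP => // /eqP X2; rewrite /D max_min_over.
Qed.
End Potential.

(** * Ratios of pairwise densities *)

(** Adding a point may reorder the enumeration of a finite set, on which a product over [i < j] is
    built. For symmetric factors the square is free of it: the ordered pairs split into [i < j] and
    [j < i], with equal products. *)
Lemma prod_pairs_sqr (A : comNzRingType) (K : choiceType) (X : {fset K}) (h : K -> K -> A) :
  (forall x y, h x y = h y x) ->
  (\prod_(i < #|` X|) \prod_(j < #|` X| | (i < j)%N)
     h (tnth (in_tuple X) i) (tnth (in_tuple X) j)) ^+ 2 =
  \prod_(x <- X) \prod_(y <- X | x != y) h x y.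
Proof.
move=> hC; rewrite [RHS]big_tnth; under [RHS]eq_bigr do rewrite big_tnth.
have inj i j : (tnth (in_tuple X) i == tnth (in_tuple X) j) = (i == j).
  apply: inj_eq; apply/tuple_uniqP; exact: fset_uniq.
under [RHS]eq_bigr => i _.
  rewrite (bigID (fun j : 'I_(size X) => (i < j)%N)) /=.
  rewrite (eq_bigl (fun j : 'I_(size X) => (i < j)%N)); last first.
    by move=> j; rewrite inj -val_eqE /=; case: ltngtP.
  rewrite [X in _ * X](eq_bigl (fun j : 'I_(size X) => (j < i)%N)); last first.
    by move=> j; rewrite inj -val_eqE /=; case: ltngtP.
  over.
rewrite big_split expr2; congr (_ * _) => /=.
rewrite [RHS](exchange_big_dep xpredT) //=; apply: eq_bigr => i _.
by apply: eq_bigr => j _; rewrite hC.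
Qed.

(** The new point occurs in first and in second position, hence the square. *)
Lemma prod_pairs_U1 (A : comNzRingType) (K : choiceType) (X : {fset K}) u (h : K -> K -> A) :
  (forall x y, h x y = h y x) -> u \notin X ->
  \prod_(x <- (u |` X)%fset) \prod_(y <- (u |` X)%fset | x != y) h x y =
  (\prod_(y <- X) h u y) ^+ 2 *
    \prod_(x <- X) \prod_(y <- X | x != y) h x y.
Proof.
move=> hC uX; rewrite big_fsetU1 //= big_mkcond big_fsetU1 //= eqxx mul1r.
rewrite expr2 -mulrA; congr (_ * _).
  rewrite big_seq [RHS]big_seq; apply: eq_bigr => y yX; rewrite ifT //.
  by apply: contraNneq uX => ->.
rewrite -big_split /=; rewrite big_seq [RHS]big_seq; apply: eq_bigr => x xX.
rewrite big_mkcond big_fsetU1 //= -big_mkcond /= ifT; first by rewrite hC.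
by apply: contraNneq uX => <-.
Qed.

Lemma prod_pairs_sub (A : comNzRingType) (K : choiceType) (X Y : {fset K}) (F : K -> K -> A) :
  (Y `<=` X)%fset ->
  (forall x y, x \in X -> y \in X -> ~~ ((x \in Y) && (y \in Y)) -> F x y = 1) ->
  \prod_(x <- X) \prod_(y <- X | x != y) F x y =
  \prod_(x <- Y) \prod_(y <- Y | x != y) F x y.
Proof.
move=> YX F1; rewrite -[LHS](big_fset_incl _ YX) => [|x xX xY].
  rewrite big_seq [RHS]big_seq; apply: eq_bigr => x xY.
  rewrite big_mkcond [RHS]big_mkcond /=.
  rewrite -[LHS](big_fset_incl _ YX) // => y yX yY.
  case: ifP => // _; apply: F1 => //; first exact: (fsubsetP YX).
  by rewrite (negPf yY) andbF.
rewrite big_seq_cond big1 // => y /andP[yX _]; apply: F1 => //.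
by rewrite (negPf xY).
Qed.

Section Density.
Variables (R : realType) (G : euclidean_graph R).
Hypothesis hG : is_tree G.
Implicit Types (X Y : config G) (u x y : network G) (gam : config G -> R).
Local Open Scope fset_scope.

Definition edge_weight gam X x y : R :=
  if `[< delaunay X x y >] then gam [fset x; y] else 1.

Definition edge_product gam X : R :=
  \prod_(x <- X) \prod_(y <- X | x != y) edge_weight gam X x y.

Lemma delaunayC X x y : `[< delaunay X x y >] = `[< delaunay X y x >].
Proof. by apply: asbool_equiv_eq; split; exact: delaunay_sym. Qed.

Lemma edge_weightC gam X x y : edge_weight gam X x y = edge_weight gam X y x.
Proof. by rewrite /edge_weight delaunayC fsetUC. Qed.

(* The product over ordered pairs counts every related pair twice. *)
Lemma pairwise_densityE gam X : (forall Y, 0 <= gam Y) ->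
  pairwise_density gam X =
  (0 < gam X)%R%:R * (\prod_(x <- X) gam [fset x]) * Num.sqrt (edge_product gam X).
Proof.
move=> g0; rewrite /pairwise_density; congr (_ * _ * _); first by rewrite big_tnth.
rewrite /edge_product -prod_pairs_sqr; last exact: edge_weightC.
rewrite sqrtr_sqr ger0_norm; last first.
  by apply: prodr_ge0 => i _; apply: prodr_ge0 => j _; rewrite /edge_weight; case: ifP.
by apply: eq_bigr => i _; rewrite big_mkcondr.
Qed.

Definition edge_ratio gam u X x y : R :=
  edge_weight gam (u |` X) x y / edge_weight gam X x y.

(** Adding [u] creates no relation between old points, and a relation that it destroys has both ends
    adjacent to [u]. *)
Lemma edge_weight_local gam u X x y : x \in X -> y \in X ->
  ~~ ((x \in nbrs u X) && (y \in nbrs u X)) ->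
  edge_weight gam (u |` X) x y = edge_weight gam X x y.
Proof.
move=> xX yX n; rewrite /edge_weight.
suff -> : `[< delaunay (u |` X) x y >] = `[< delaunay X x y >] by [].
apply: asbool_equiv_eq; split=> [|d].
  by apply: delaunay_sub => //; exact: fsubsetUr.
apply: contrapT => nd; move/negP: n; apply; apply/andP; split; apply/nbrsP; split=> //.
  exact: (delaunay_lost hG d nd).
apply: (delaunay_lost hG (delaunay_sym d)) => d'; apply: nd; exact: delaunay_sym.
Qed.

(** Factors of pairs not both adjacent to [u] agree in numerator and denominator, and positivity on
    pairs allows them to be cancelled. *)
Lemma edge_product_ratio gam u X : u \notin X ->
  (forall x y, x \in X -> y \in X -> 0 < gam [fset x; y]) ->
  edge_product gam (u |` X) / edge_product gam X =
  (\prod_(y <- nbrs u X) gam [fset u; y]) ^+ 2 *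
  \prod_(x <- nbrs u X) \prod_(y <- nbrs u X | x != y) edge_ratio gam u X x y.
Proof.
move=> uX gpos.
have wpos x y : x \in X -> y \in X -> 0 < edge_weight gam X x y.
  by move=> xX yX; rewrite /edge_weight; case: ifP => // _; exact: gpos.
have uE : \prod_(y <- X) edge_weight gam (u |` X) u y = \prod_(y <- nbrs u X) gam [fset u; y].
  rewrite -[LHS](big_fset_incl _ (nbrs_sub u X)) => [|y yX yY].
    rewrite big_seq [RHS]big_seq; apply: eq_bigr => y /nbrsP[_ d].
    by rewrite /edge_weight ifT //; apply/asboolP; exact: delaunay_sym.
  rewrite /edge_weight ifF //; apply/asboolP => d; move/negP: yY; apply.
  by apply/nbrsP; split=> //; exact: delaunay_sym.
have PE : edge_product gam (u |` X) = (\prod_(y <- nbrs u X) gam [fset u; y]) ^+ 2 *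
    \prod_(x <- X) \prod_(y <- X | x != y) edge_weight gam (u |` X) x y.
  by rewrite -uE; exact: (prod_pairs_U1 (edge_weightC gam _) uX).
apply: etrans (congr1 (fun t => t / edge_product gam X) PE) _.
rewrite -mulrA; congr (_ * _).
apply: etrans (prod_pairs_sub (nbrs_sub u X) _) => [|x y xX yX n]; last first.
  by rewrite /edge_ratio edge_weight_local // divff // gt_eqF // wpos.
rewrite -prodf_div; apply: eq_bigr => x _; rewrite -prodf_div.
by apply: eq_bigr => y _.
Qed.

(** A positive ratio is [gam [fset u]] times the root of a quotient of edge products, and that
    quotient sees only the neighbours of [u] and their relations. Whether the ratio is positive is
    also decided there, by the interaction condition. *)
Lemma pairwise_density_markov (p gam : config G -> R) (c : R) :
  (forall X, 0 <= gam X) -> interaction_function gam -> 0 < c ->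
  (forall X, general_position X -> p X = c * pairwise_density gam X) ->
  markov_function p.
Proof.
move=> g0 gI c0 pE.
have gpos X : general_position X -> 0 < p X -> 0 < gam X.
  move=> gX; rewrite pE // /pairwise_density lt_neqAle eq_sym => /andP[+ _].
  by case: (0 < gam X)%R => //; rewrite !mul0r mulr0 eqxx.
have posE X : general_position X -> 0 < gam X ->
    [/\ forall Y, Y `<=` X -> 0 < gam Y, 0 < edge_product gam X
      & 0 < \prod_(x <- X) gam [fset x]].
  move=> gX /(gI _ gX)[sub _]; split=> //.
    rewrite /edge_product big_seq; apply: prodr_gt0 => x xX; rewrite big_seq_cond.
    apply: prodr_gt0 => y /andP[yX _]; rewrite /edge_weight; case: ifP => // _.
    by apply: sub; rewrite fsubUset !fsub1set xX.
  by rewrite big_seq; apply: prodr_gt0 => x xX; apply: sub; rewrite fsub1set.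
have ppos X : general_position X -> 0 < gam X -> 0 < p X.
  move=> gX gx; have [_ e0 v0] := posE X gX gx.
  by rewrite pE // pairwise_densityE // gx mul1r !mulr_gt0 // sqrtr_gt0.
have gamN X u : general_position X -> general_position (u |` X) -> 0 < p X ->
    (0 < gam (u |` X)) = (0 < gam (neighbours [fset u] (u |` X))).
  move=> gX gXu /(gpos _ gX) gx; apply/idP/idP => [/(gI _ gXu)[sub _]|].
    by apply: sub; apply/fsubsetP => x; rewrite in_neighbours => /asboolP[].
  by apply: (gI _ gX gx).2.
have ratio X u : u \notin X -> general_position X -> general_position (u |` X) -> 0 < p X ->
    0 < gam (u |` X) ->
    p (u |` X) / p X = gam [fset u] *
      Num.sqrt (edge_product gam (u |` X) / edge_product gam X).
  move=> uX gX gXu pX gu; have gx := gpos _ gX pX.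
  have [_ e0 v0] := posE X gX gx; have [_ eu0 vu0] := posE _ gXu gu.
  rewrite !pE // !pairwise_densityE // gu gx !mul1r big_fsetU1 //= sqrtrM ?(ltW eu0) //.
  rewrite sqrtrV ?(ltW e0) //; have := sqrtr_gt0 (edge_product gam X); rewrite e0.
  move: (Num.sqrt (edge_product gam X)) => s s0; set V := \prod_(_ <- _) _ in v0 *.
  by field; rewrite !gt_eqF.
have p0 X : general_position X -> (0 < gam X) = false -> p X = 0.
  by move=> gX gx; rewrite pE // /pairwise_density gx !mul0r mulr0.
(* The local data thus reveal whether [u] is already present, so the trivial ratio 1 occurs for [X]
   and [X'] together. *)
have nbrs_self X u : (u \in nbrs u X) = (u \in X).
  apply/nbrsP/idP => [[]//|uX]; split=> //.
  by apply: (delaunay_refl hG); exact: fset1U1.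
move=> X gX pX; have gx := gpos _ gX pX; have [sub e0 v0] := posE X gX gx; split.
  by move=> Y YX; apply: ppos; [exact: general_position_sub gX|exact: sub].
move=> u gXu X' gX' pX' gX'u [NE d1 d2].
have {}NE : nbrs u X' = nbrs u X by exact: esym NE.
have uXX' : (u \in X') = (u \in X) by rewrite -[LHS]nbrs_self NE nbrs_self.
have [uX|uX] := boolP (u \in X).
  by rewrite !mem_fset1U ?uXX' // !divff // gt_eqF.
have uX' : u \notin X' by rewrite uXX'.
have NN : neighbours [fset u] (u |` X') = neighbours [fset u] (u |` X).
  by rewrite !(neighboursE hG) NE.
have gE : (0 < gam (u |` X')) = (0 < gam (u |` X)) by rewrite !gamN // NN.
have [gu|gu] := boolP (0 < gam (u |` X)); last first.
  have g0u := negPf gu; rewrite (p0 _ gXu g0u) (p0 _ gX'u) ?mul0r //.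
  by rewrite gE.
have gu' : 0 < gam (u |` X') by rewrite gE.
rewrite !ratio //; congr (_ * Num.sqrt _).
have pair Z : general_position Z -> 0 < p Z ->
    forall x y, x \in Z -> y \in Z -> 0 < gam [fset x; y].
  move=> gZ pZ x y xZ yZ; have [s _ _] := posE _ gZ (gpos _ gZ pZ).
  by apply: s; rewrite fsubUset !fsub1set xZ.
rewrite !edge_product_ratio ?NE; try exact: pair; try by [].
congr (_ * _); rewrite big_seq [RHS]big_seq; apply: eq_bigr => x xN.
rewrite big_seq_cond [RHS]big_seq_cond; apply: eq_bigr => y /andP[yN _].
have inN z : z \in nbrs u X -> z \in neighbours [fset u] (u |` X).
  by rewrite /nbrs in_fsetI => /andP[].
by rewrite /edge_ratio /edge_weight (asbool_equiv_eq (d1 _ _ (inN _ xN) (inN _ yN)))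
  (asbool_equiv_eq (d2 _ _ (inN _ xN) (inN _ yN))).
Qed.
End Density.

(** * Factorization of Markov functions *)

Section SmallSets.
Variable K : choiceType.
Implicit Types (a b c : K) (X : {fset K}).
Local Open Scope fset_scope.

Lemma cardfs_gt2 X : (2 < #|` X|)%N <->
  exists a b c, [/\ a \in X, b \in X & c \in X] /\ [/\ a != b, b != c & a != c].
Proof.
split=> [|[a [b [c [[aX bX cX] [ab bc ac]]]]]].
  have memX x : (x \in X) = (x \in enum_fset X) by [].
  have := fset_uniq X; move: memX; case: (enum_fset X) => [|a [|b [|c s]]] //= memX.
  rewrite !inE !negb_or => /and4P[/and3P[ab ac _] /andP[bc _] _ _] _.
  by exists a, b, c; rewrite !memX !inE !eqxx !orbT.
rewrite (cardfsD1 a X) aX (cardfsD1 b (X `\ a)) (cardfsD1 c (X `\ a `\ b)).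
by rewrite !inE eq_sym ab bX eq_sym bc eq_sym ac cX.
Qed.

Lemma cardfs2_ex X : #|` X| = 2%N -> exists a b, a != b /\ X = [fset a; b].
Proof.
have memX x : (x \in X) = (x \in enum_fset X) by [].
have := fset_uniq X; move: memX; case: (enum_fset X) => [|a [|b [|? ?]]] //= memX.
rewrite !inE andbT => ab _; exists a, b; split=> //.
by apply/fsetP => x; rewrite memX in_fset2 !inE.
Qed.

Lemma prod_fset2 (A : comNzRingType) (h : K -> A) a b : a != b ->
  \prod_(x <- [fset a; b]) h x = h a * h b.
Proof. by move=> ab; rewrite big_fsetU1 ?inE //= big_seq_fset1. Qed.

Lemma prod_pairs_fset2 (A : comNzRingType) (h : K -> K -> A) a b :
  (forall x y, h x y = h y x) -> a != b ->
  \prod_(x <- [fset a; b]) \prod_(y <- [fset a; b] | x != y) h x y = h a b ^+ 2.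
Proof.
move=> hC ab; rewrite (prod_pairs_U1 hC) ?inE // !big_seq_fset1 big_mkcond big_seq_fset1 eqxx.
by rewrite mulr1.
Qed.

Lemma prod_pairs_small (A : comNzRingType) (h : K -> K -> A) X : (#|` X| <= 1)%N ->
  \prod_(x <- X) \prod_(y <- X | x != y) h x y = 1.
Proof.
rewrite leq_eqVlt ltnS leqn0 cardfs_eq0 => /orP[/cardfs1P[a ->]|/eqP ->]; last first.
  by rewrite big_seq_fset0.
by rewrite big_seq_fset1 big_mkcond big_seq_fset1 eqxx.
Qed.
End SmallSets.

Section HammersleyClifford.
Variables (R : realType) (G : euclidean_graph R) (p : config G -> R).
Hypotheses (hG : is_tree G) (p_ge0 : forall X, 0 <= p X).
Hypotheses (mp : markov_function p) (p0 : 0 < p fset0).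
Implicit Types (X Y : config G) (u x y : network G).
Local Open Scope fset_scope.

Lemma potential_gt0 X : general_position X -> (0 < potential p X) = (0 < p X).
Proof.
move=> gX; rewrite /potential; case: eqP => [/cardfs0_eq ->|_]; first by rewrite ltr01 p0.
case: eqP => _; first by rewrite pmulr_lgt0 // invr_gt0.
case: eqP => X2; last by case: ifP; rewrite ?ltr01 ?ltxx.
have [pX|pX] := boolP (0 < p X); last first.
  have -> : p X = 0 by apply/eqP; move: pX; rewrite lt_neqAle p_ge0 andbT negbK eq_sym.
  by rewrite !mul0r ltxx.
rewrite divr_gt0 ?mulr_gt0 // big_seq prodr_gt0 // => x xX.
by apply: (mp gX pX).1; rewrite fsub1set.
Qed.

Lemma markov_ratio_nbrs X u : u \notin X -> general_position (u |` X) -> 0 < p X ->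
  0 < p (nbrs u X) /\ p (u |` X) / p X = p (u |` nbrs u X) / p (nbrs u X).
Proof.
move=> uX gXu pX.
have gX : general_position X by apply: general_position_sub gXu; exact: fsubsetUr.
have [sub ratio] := mp gX pX.
have pY := sub _ (nbrs_sub u X); split=> //.
apply: ratio => //; first by apply: general_position_sub gX; exact: nbrs_sub.
  by apply: (general_position_sub _ gXu); apply: fsetUS; exact: nbrs_sub.
exact: same_local_data_nbrs.
Qed.

(** In condition (b) the ratio of [p] at the neighbours of [u] is positive, and it equals the ratio
    at [X]. *)
Lemma potential_interaction : interaction_function (potential p).
Proof.
move=> X gX; rewrite potential_gt0 // => pX; split=> [Y YX|u gXu].
  by rewrite potential_gt0; [exact: (mp gX pX).1|exact: (general_position_sub YX)].
have [uX|uX] := boolP (u \in X); first by rewrite mem_fset1U // => _; rewrite potential_gt0.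
rewrite neighboursE // !potential_gt0 //; last first.
  by apply: (general_position_sub _ gXu); apply: fsetUS; exact: nbrs_sub.
have [pY e] := markov_ratio_nbrs uX gXu pX => pYu.
have : 0 < p (u |` X) / p X by rewrite e divr_gt0.
by rewrite pmulr_lgt0 // invr_gt0.
Qed.

Lemma pairwise_density_potential X : general_position X ->
  p X = p fset0 * pairwise_density (potential p) X.
Proof.
pose q X := p fset0 * pairwise_density (potential p) X.
have qM : markov_function q.
  exact: (pairwise_density_markov hG (potential_ge0 p_ge0) potential_interaction p0).
rewrite -/(q X); have [n] := ubnP #|` X|; elim: n X => // n IH X; rewrite ltnS => Xn gX.
have dE := pairwise_densityE X (potential_ge0 p_ge0).
have [pX|pX] := boolP (0 < p X); last first.
  rewrite /q dE potential_gt0 // (negPf pX) !mul0r mulr0.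
  by apply/eqP; move: pX; rewrite lt_neqAle p_ge0 andbT negbK eq_sym.
have sub := (mp gX pX).1.
have pot1 x : potential p [fset x] = p [fset x] / p fset0.
  by rewrite /potential cardfs1.
have [X1|] := leqP #|` X| 1.
  rewrite /q dE potential_gt0 // pX mul1r /edge_product prod_pairs_small // sqrtr1 mulr1.
  move: X1; rewrite leq_eqVlt ltnS leqn0 cardfs_eq0 => /orP[/cardfs1P[x ->]|/eqP ->]; last first.
    by rewrite big_seq_fset0 mulr1.
  by rewrite big_seq_fset1 pot1 mulrC divfK // gt_eqF.
rewrite leq_eqVlt => /orP[/eqP/esym/cardfs2_ex[x [y [xy XE]]]|X3].
  have px : 0 < p [fset x] by apply: sub; rewrite XE fsub1set fset21.
  have py : 0 < p [fset y] by apply: sub; rewrite XE fsub1set fset22.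
  have xX : x \in X by rewrite XE fset21.
  have yX : y \in X by rewrite XE fset22.
  (* Two points alone are always related: their midpoint lies in both cells. *)
  have dxy : delaunay X x y.
    have [m [xm my]] := dG_mid hG x y; rewrite (dGC hG) in xm.
    split=> //; exists m; split=> z; rewrite XE => /fset2P[] ->; rewrite ?xm ?my /= ?xm ?my lexx //.
  have potX : potential p X = p X * p fset0 / (p [fset x] * p [fset y]).
    have X2 : #|` X| = 2%N by rewrite XE cardfs2 xy.
    by rewrite /potential X2 /=; congr (_ / _); rewrite XE prod_fset2.
  rewrite /q dE potential_gt0 // pX mul1r.
  have -> : \prod_(z <- X) potential p [fset z] = p [fset x] / p fset0 * (p [fset y] / p fset0).
    by rewrite XE prod_fset2 // !pot1.
  have -> : edge_product (potential p) X = potential p X ^+ 2.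
    have := prod_pairs_fset2 (edge_weightC (potential p) X) xy; rewrite -XE /edge_product => ->.
    by rewrite /edge_weight asboolT // -XE.
  rewrite sqrtr_sqr ger0_norm ?potential_ge0 // potX.
  have cancel (t b c d : R) : 0 < b -> 0 < c -> 0 < d ->
      t = b * (c / b * (d / b) * (t * b / (c * d))).
    by move=> b0 c0 d0; field; rewrite !gt_eqF.
  exact: cancel.
have [a [b [c [[aX bX cX] [ab bc ac]]]]] := (cardfs_gt2 X).1 X3.
have [u [v [uX vX uv nd]]] : exists u v, [/\ u \in X, v \in X, u != v & ~ delaunay X v u].
  have [dab|?] := pselect (delaunay X a b); last by exists b, a; rewrite eq_sym.
  have [dbc|?] := pselect (delaunay X b c); last by exists c, b; rewrite eq_sym.
  have [dac|?] := pselect (delaunay X a c); last by exists c, a; rewrite eq_sym.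
  by case: (delaunay_no_triangle hG gX ab bc ac dab dbc dac).
set X' := X `\ u; have XE : u |` X' = X by exact: fsetD1K.
have uX' : u \notin X' by rewrite /X' in_fsetD1 eqxx.
have Xcard : #|` X| = #|` X'|.+1 by rewrite (cardfsD1 u X) uX.
have X'X : X' `<=` X by rewrite -XE; exact: fsubsetUr.
have gXu : general_position (u |` X') by rewrite XE.
have pX' := sub _ X'X.
have vX' : v \in X' by rewrite /X' in_fsetD1 eq_sym uv.
have Yv : nbrs u X' `<=` X' `\ v.
  apply/fsubsetP => x xY; have [xX' d] := nbrsP _ _ _ xY; rewrite in_fsetD1 xX' andbT.
  by apply/eqP => xv; apply: nd; rewrite -XE -xv.
(* Strictness, due to the missing [v], leaves room for [u]: with [u] added, its neighbours still
   form a smaller configuration than [X]. *)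
have Ycard : (#|` nbrs u X'| < #|` X'|)%N.
  by rewrite (cardfsD1 v X') vX' ltnS; exact: fsubset_leq_card.
have gX' := general_position_sub X'X gX.
have gYu : general_position (u |` nbrs u X').
  by apply: (general_position_sub _ gXu); apply: fsetUS; exact: nbrs_sub.
have gY : general_position (nbrs u X') by apply: general_position_sub gX'; exact: nbrs_sub.
have [pY pE] := markov_ratio_nbrs uX' gXu pX'.
have q' : p X' = q X' by apply: IH => //; rewrite -ltnS -Xcard.
have qY : p (nbrs u X') = q (nbrs u X').
  by apply: IH => //; apply: leq_trans Ycard _; rewrite -ltnS -Xcard ltnW.
have qYu : p (u |` nbrs u X') = q (u |` nbrs u X').
  apply: IH => //; apply: leq_trans Xn; rewrite Xcard ltnS.
  by apply: leq_trans Ycard; rewrite cardfsU1; case: (_ \notin _).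
have qX'_gt0 : 0 < q X' by rewrite -q'.
have qY_gt0 : 0 < q (nbrs u X') by rewrite -qY.
have := (qM _ gX' qX'_gt0).2 u gXu _ gY qY_gt0 gYu (same_local_data_nbrs hG uX' gXu).
rewrite -q' -qY -qYu -pE XE => /mulIf -> //.
by rewrite invr_eq0 gt_eqF.
Qed.

End HammersleyClifford.

Theorem theorem2 (R : realType) (G : euclidean_graph R) (hG : is_tree G)
    (p : config G -> R) (mp : config_measurable p)
    (p_ge0 : forall X, 0 <= p X) :
  markov_function p <->
  exists gam : config G -> R,
    config_measurable gam /\
    (forall X, 0 <= gam X) /\
    interaction_function gam /\
    exists c : R, 0 < c /\
      forall X, general_position X -> p X = c * pairwise_density gam X.
Proof.
split=> [pM|[gam [_ [gam0 [gamI [c [c0 pE]]]]]]]; last first.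
  exact: (pairwise_density_markov hG gam0 gamI c0 pE).
have [p0|p0] := boolP (0 < p fset0%fset).
  exists (potential p); split; first exact: measurable_potential.
  split; first exact: potential_ge0.
  split; first exact: potential_interaction.
  by exists (p fset0%fset); split=> // X; exact: pairwise_density_potential.
(* If [p] vanishes at the empty configuration, hereditary positivity makes it vanish on all
   configurations in general position, and the zero potential represents it. *)
exists (fun=> 0); split; first exact: measurable_cst.
split=> //; split; first by move=> X _; rewrite ltxx.
exists 1; split=> // X gX; rewrite /pairwise_density ltxx !mul0r mulr0.
apply/eqP; rewrite eq_le p_ge0 andbT leNgt; apply: contra p0 => pX.
by apply: (pM X gX pX).1; exact: fsub0set.
Qed.
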